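(* Let $M$ be a compact oriented $n$-manifold with faces and $(\mathcal Y,\omega_{\mathcal Y}=\mathrm d_{\mathcal Y}\alpha_{\mathcal Y},\mathsf Q_{\mathcal Y},\Theta)$ an exact Hamiltonian dg symplectic target of AKSZ degree $n-1$. For $p\in\mathbb Z$, let $\mathcal C^p(M,\mathcal Y)$ consist of families $$\eta=\{\eta_F^k\}_{F\in\mathfrak F(M),\,k\ge0},\qquad \eta_F^k\in\Omega^{p-k}(\mathcal F_F),$$ with the convention $\Omega^q(\mathcal F_F)=0$ for $q<0$. Put $\eta_F^{-1}=0$ and define $$(\mathbf D\eta)_F^k:=(-1)^{\dim F}\delta\eta_F^k+\sum_{G\prec F}[F:G]\,\rho_{FG}^*\eta_G^{k-1}.$$ Then $\mathbf D^2=0$. Moreover, the factorially normalized facewise transgression $$\mathbf T(\chi)_F^k:=\frac1{k!}\mathsf T_F^k\chi,\qquad\chi\in\Omega^p(\mathcal Y),$$ defines a cochain map $$\mathbf T:(\Omega^\bullet(\mathcal Y),\mathrm d_{\mathcal Y})\longrightarrow(\mathcal C^\bullet(M,\mathcal Y),\mathbf D).$$ In particular, a closed target form transgresses to a $\mathbf D$-cocycle, while exactness of the target symplectic form gives $$\mathbf D\mathbf T(\alpha_{\mathcal Y})=\mathbf T(\omega_{\mathcal Y}),\qquad \mathbf D\mathbf T(\omega_{\mathcal Y})=0 .$$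
   Context: Manifolds with faces. A compact $n$-dimensional manifold with faces is a compact smooth manifold with corners $M$ (local models $[0,\infty)^r\times\mathbb R^{n-r}$) in which every boundary hypersurface is embedded. A face is the closure of a connected stratum; $\mathfrak F(M)$ is the finite set of all faces of all codimensions (including $M$ itself when connected). Every face is again a manifold with faces. Orientations of all faces are fixed once and for all, that of $M$ being the given one. $G\prec F$ means that $G$ is a codimension-one face of the face $F$; $[F:G]\in\{+1,-1\}$ compares the orientation of $G$ induced from $F$ by the outward-normal-first convention with the fixed orientation of $G$. Target. An exact Hamiltonian dg symplectic target of AKSZ degree $n-1$ is $(\mathcal Y,\omega_{\mathcal Y}=\mathrm d_{\mathcal Y}\alpha_{\mathcal Y},\mathsf Q_{\mathcal Y},\Theta)$ with $\mathcal Y$ a graded manifold, $\omega_{\mathcal Y}$ a symplectic two-form of internal degree $n-1$, $\mathsf Q_{\mathcal Y}$ a degree-$1$ cohomological vector field, $\iota_{\mathsf Q_{\mathcal Y}}\omega_{\mathcal Y}=\mathrm d_{\mathcal Y}\Theta$ with $\Theta$ of degree $n$, and $\{\Theta,\Theta\}_{\mathcal Y}=0$. Formal mapping-space hypothesis (standing). For every face $F$ the graded mapping space $\mathcal F_F=\mathrm{Map}(T[1]F,\mathcal Y)$ admits the evaluation map, restriction maps, contractions by the lifted source and target vector fields, and fiber integration of local forms, and these operations satisfy graded Cartan calculus and Stokes' formula. Formulas are read as identities between local functionals and local field-space forms (or on a regular finite-dimensional approximation where the fiber integrals and pullbacks are defined). Mapping-space data. Let $m=\dim F$. $\mathrm{ev}_F:\mathcal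 F_F\times T[1]F\to\mathcal Y$ is evaluation, $p_F:\mathcal F_F\times T[1]F\to\mathcal F_F$ the projection, $(p_F)_*$ Berezin fiber integration (degree $-m$), $\rho_{FG}:\mathcal F_F\to\mathcal F_G$ restriction of maps, $\delta$ the de Rham differential on field space. $D_F$ is the source de Rham vector field on $T[1]F$ and $\widehat D_F$ its lift to $\mathcal F_F$ by precomposition. For $\chi\in\Omega^p(\mathcal Y)$: $\mathsf T_F^0\chi=(p_F)_*\mathrm{ev}_F^*\chi$ and $\mathsf T_F^k\chi=\iota_{\widehat D_F}^{\,k}\mathsf T_F^0\chi$ for $k\ge0$. Sign conventions: $\delta\circ(p_F)_*=(-1)^m(p_F)_*\circ\delta$; the source de Rham differential and $\delta$ anticommute; $\iota_{\widehat D_F}$ is an even derivation; Stokes: integrating the source differential over $T[1]F$ gives $\sum_{G\prec F}[F:G]\rho_{FG}^*$ of the integral over $T[1]G$, with no further sign. *)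

(* Defs.v *)
From HB Require Import structures.
From mathcomp Require Import all_boot all_order all_algebra.
From mathcomp Require Import all_classical all_reals all_analysis.

Set Implicit Arguments.
Unset Strict Implicit.
Unset Printing Implicit Defensive.

Import Order.TTheory GRing.Theory Num.Theory.
Import numFieldNormedType.Exports.

Local Open Scope classical_set_scope.
Local Open Scope ring_scope.

Definition iter_partial (R : realType) (n : nat) (f : 'rV[R]_n -> 'rV[R]_n)
    (s : seq 'I_n) : 'rV[R]_n -> 'rV[R]_n :=
  foldr (fun i g q => 'D_(delta_mx ord0 i) g q) f s.

(* f is C^oo on a neighbourhood of p: there, every iterated partial derivative
   of f is Frechet differentiable. *)
Definition smooth_near (R : realType) (n : nat) (p : 'rV[R]_n)
    (f : 'rV[R]_n -> 'rV[R]_n) : Prop :=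
  \forall q \near p, forall s : seq 'I_n, differentiable (iter_partial f s) q.

Record chart (R : realType) (n : nat) (X : topologicalType) := Chart {
  chart_dom : set X;
  chart_rank : nat;
  chart_coord : X -> 'rV[R]_n }.

(* The local model [0,oo)^r x R^(n-r). *)
Definition corner_model (R : realType) (n r : nat) : set 'rV[R]_n :=
  [set v | forall i : 'I_n, (i < r)%N -> 0 <= v ord0 i].
Arguments corner_model : clear implicits.

(* A homeomorphism from an open set onto a relatively open subset of the
   model; only the values of chart_coord on chart_dom are meaningful. *)
Definition is_chart (R : realType) (n : nat) (X : topologicalType)
    (c : chart R n X) : Prop :=
  [/\ (chart_rank c <= n)%N,
      open (chart_dom c),
      forall x, chart_dom c x -> {for x, continuous (chart_coord c)},
      forall x y, chart_dom c x -> chart_dom c y ->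
        chart_coord c x = chart_coord c y -> x = y &
      forall V : set X, open V -> V `<=` chart_dom c ->
        exists2 W : set 'rV[R]_n, open W &
          chart_coord c @` V = W `&` corner_model R n (chart_rank c)].

(* f is a smooth local extension, around the image of x, of the coordinate
   change from c to c'. *)
Definition is_transition (R : realType) (n : nat) (X : topologicalType)
    (c c' : chart R n X) (x : X) (f : 'rV[R]_n -> 'rV[R]_n) : Prop :=
  smooth_near (chart_coord c x) f /\
  \forall y \near x, f (chart_coord c y) = chart_coord c' y.

Record manifold_with_corners (R : realType) (n : nat) := ManifoldWithCorners {
  points :> topologicalType;
  atlas : set (chart R n points);
  points_hausdorff : hausdorff_space points;
  points_second_countable : @second_countable points;
  atlas_chart : forall c, atlas c -> is_chart c;
  atlas_cover : forall x, exists2 c, atlas c & chart_dom c x;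
  atlas_smooth : forall c c' x, atlas c -> atlas c' ->
    chart_dom c x -> chart_dom c' x -> exists f, is_transition c c' x f }.

(* The coordinates that vanish at x among the nonnegative ones. *)
Definition boundary_coords (R : realType) (n : nat) (X : topologicalType)
    (c : chart R n X) (x : X) : {set 'I_n} :=
  [set i : 'I_n | (i < chart_rank c)%N && (chart_coord c x ord0 i == 0)]%SET.

Definition stratum (R : realType) (n : nat) (M : manifold_with_corners R n)
    (k : nat) : set M :=
  [set x | exists c, [/\ atlas c, chart_dom c x & #|boundary_coords c x| = k]].
Arguments stratum {R n} M k _.

(* A face is encoded by its codimension k and its open part, a connected
   component of the stratum of codimension k; the face itself is the closure
   closed_face of this open part. *)
Definition faces (R : realType) (n : nat) (M : manifold_with_corners R n) :
    set (nat * set M) :=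
  [set kC | exists2 x, stratum M kC.1 x &
                       kC.2 = connected_component (stratum M kC.1) x].
Arguments faces {R n} M _.

Definition codim (R : realType) (n : nat) (M : manifold_with_corners R n)
  (F : faces M) : nat := (val F).1.

Definition dim (R : realType) (n : nat) (M : manifold_with_corners R n)
  (F : faces M) : nat := (n - codim F)%N.

Definition open_face (R : realType) (n : nat) (M : manifold_with_corners R n)
  (F : faces M) : set M := (val F).2.

Definition closed_face (R : realType) (n : nat) (M : manifold_with_corners R n)
  (F : faces M) : set M := closure (open_face F).

Definition subface (R : realType) (n : nat) (M : manifold_with_corners R n)
  (G F : faces M) : Prop := closed_face G `<=` closed_face F.

Definition facet (R : realType) (n : nat) (M : manifold_with_corners R n)
  (G F : faces M) : Prop := subface G F /\ codim G = (codim F).+1.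

(* Every boundary hypersurface is embedded: in each chart, near each of its
   points, it is a single coordinate hyperplane of the model. *)
Definition has_embedded_hypersurfaces (R : realType) (n : nat)
    (M : manifold_with_corners R n) : Prop :=
  forall H : faces M, codim H = 1%N ->
  forall c x, atlas c -> chart_dom c x -> closed_face H x ->
  exists2 i : 'I_n, i \in boundary_coords c x &
    \forall y \near x, closed_face H y <-> chart_coord c y ord0 i = 0.

Record manifold_with_faces (R : realType) (n : nat) := ManifoldWithFaces {
  mwf_corners :> manifold_with_corners R n;
  mwf_embedded : has_embedded_hypersurfaces mwf_corners }.

(* Orientations.  The rows of an m x n matrix are tangent vectors written in
   the coordinates of a chart; an orientation says which frames are positively
   oriented.  The number m of vectors is an argument, and only its value m =
   dimension is ever constrained. *)

Definition frame_sign (R : realType) (n : nat) (M : manifold_with_corners R n) :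
    Type :=
  chart R n M -> M -> forall m : nat, 'M[R]_(m, n) -> bool.

(* All the rows of w lie in the coordinate subspace {v | v_i = 0, i in Z}. *)
Definition rows_tangent (R : realType) (m n : nat) (Z : {set 'I_n})
    (w : 'M[R]_(m, n)) : Prop :=
  forall (a : 'I_m) (i : 'I_n), i \in Z -> w a i = 0.

(* An orientation of the codimension-k submanifold S whose tangent space at x
   is, in the chart c, the coordinate subspace {v | v_i = 0, i in Z c x}. *)
Definition is_orientation (R : realType) (n : nat)
    (M : manifold_with_corners R n) (S : set M) (k : nat)
    (Z : chart R n M -> M -> {set 'I_n}) (o : frame_sign M) : Prop :=
  forall c x m (v : 'M[R]_(m, n)), atlas c -> chart_dom c x -> S x ->
    (m + k)%N = n -> row_free v -> rows_tangent (Z c x) v ->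
  [/\ forall A : 'M[R]_m, A \in unitmx ->
        o c x m (A *m v) = o c x m v (+) (\det A < 0),
      forall c' f, atlas c' -> chart_dom c' x -> is_transition c c' x f ->
        o c' x m (v *m jacobian f (chart_coord c x)) = o c x m v &
      \forall y \near x, S y -> o c y m v = o c x m v].

Record face_orientations (R : realType) (n : nat)
    (M : manifold_with_corners R n) := FaceOrientations {
  orM : frame_sign M;
  orF : faces M -> frame_sign M;
  orM_P : is_orientation setT 0 (fun _ _ => finset.set0) orM;
  orF_P : forall F : faces M,
    is_orientation (open_face F) (codim F) (@boundary_coords R n M) (orF F);
  orF_M : forall F : faces M, codim F = 0%N ->
    forall c x m (v : 'M[R]_(m, n)), atlas c -> chart_dom c x ->
    open_face F x -> m = n -> row_free v -> orF F c x v = orM c x v }.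

(* v is tangent to F at the point x of a facet of F, and points strictly out
   of F. *)
Definition outward (R : realType) (n : nat) (M : manifold_with_corners R n)
    (F : faces M) (c : chart R n M) (x : M) (v : 'rV[R]_n) : Prop :=
  (exists2 i : 'I_n, i \in boundary_coords c x & v ord0 i < 0) /\
  \forall y \near x, open_face F y -> rows_tangent (boundary_coords c y) v.

Definition induced_orientation_agrees (R : realType) (n : nat)
    (M : manifold_with_corners R n) (o : face_orientations M)
    (F G : faces M) : Prop :=
  forall c x m (w : 'M[R]_(m, n)) (v : 'rV[R]_n),
    atlas c -> chart_dom c x -> open_face G x ->
    (m + codim G)%N = n -> row_free w ->
    rows_tangent (boundary_coords c x) w -> outward F c x v ->
  \forall y \near x, open_face F y ->
    orF o F c y (col_mx v w) = orF o G c x w.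

(* [F:G]: the orientation induced from F puts the outward normal first; the
   choice of point, chart, frame and outward vector is immaterial on a manifold
   with faces. *)
Definition incidence (R : realType) (n : nat) (M : manifold_with_corners R n)
    (o : face_orientations M) (F G : faces M) : R :=
  if `[< induced_orientation_agrees o F G >] then 1 else - 1.

(* De Rham calculus of a graded manifold, possibly infinite-dimensional.
   homog p j is the space of forms of form degree p and internal degree j;
   Koszul signs are governed by the total degree p + j. *)

Definition ksign (R : realType) (z : int) : R := (-1) ^+ `|z|%N.

Definition subspace (R : realType) (V : lmodType R) (A : set V) : Prop :=
  A 0 /\ forall (r : R) a b, A a -> A b -> A (r *: a + b).

Definition has_bidegree (R : realType) (V W : lmodType R)
    (hV : int -> int -> set V) (hW : int -> int -> set W) (u v : int)
    (t : V -> W) : Prop :=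
  forall p j a, hV p j a -> hW (p + u) (j + v) (t a).

Definition is_derivation (R : realType) (A : algType R)
    (h : int -> int -> set A) (e : int) (t : A -> A) : Prop :=
  linear t /\ forall p j a b, h p j a ->
    t (a * b) = t a * b + ksign R (e * (p + j)) *: (a * t b).

Record calculus (R : realType) := Calculus {
  forms :> algType R;
  homog : int -> int -> set forms;
  exd : forms -> forms;
  homog_subspace : forall p j, subspace (homog p j);
  homog_neg : forall p j a, p < 0 -> homog p j a -> a = 0;
  homog_direct : forall a, exists! c : int * int -> forms,
    [/\ forall pj, homog pj.1 pj.2 (c pj),
        finite_set [set pj | c pj != 0] &
        a = \sum_(pj \in [set: int * int]) c pj];
  homog1 : homog 0 0 1;
  homogM : forall p j q l a b, homog p j a -> homog q l b ->
    homog (p + q) (j + l) (a * b);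
  formsC : forall p j q l a b, homog p j a -> homog q l b ->
    a * b = ksign R ((p + j) * (q + l)) *: (b * a);
  exd_derivation : is_derivation homog 1 exd;
  exd_bidegree : has_bidegree homog homog 1 0 exd;
  exdK : forall a, exd (exd a) = 0 }.

(* Omega^p, all internal degrees together; it is zero for p < 0. *)
Definition pforms (R : realType) (X : calculus R) (p : int) : set X :=
  [set a | exists c : int -> X,
    [/\ forall j, homog p j (c j), finite_set [set j | c j != 0] &
        a = \sum_(j \in [set: int]) c j]].

(* A vector field of degree k is represented by its contraction operator,
   a derivation of bidegree (-1, k), hence of total degree k - 1; it acts on
   functions by f |-> i (exd f). *)
Definition vector_field (R : realType) (X : calculus R) (k : int)
    (i : X -> X) : Prop :=
  is_derivation (@homog R X) (k - 1) i /\
  has_bidegree (@homog R X) (@homog R X) (- 1) k i.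

Definition lie (R : realType) (X : calculus R) (k : int) (i : X -> X) (a : X) :
    X :=
  i (exd a) - ksign R (k - 1) *: exd (i a).

(* The contraction with the Lie bracket [X,Y], by Cartan's formula
   [L_X, i_Y] = i_[X,Y]. *)
Definition contract_bracket (R : realType) (X : calculus R) (k l : int)
    (iX iY : X -> X) (a : X) : X :=
  lie k iX (iY a) - ksign R (k * (l - 1)) *: iY (lie k iX a).

Definition cohomological (R : realType) (X : calculus R) (i : X -> X) : Prop :=
  vector_field 1 i /\ forall a, contract_bracket 1 1 i i a = 0.

Record is_pullback (R : realType) (X Y : calculus R) (f : X -> Y) : Prop :=
  IsPullback {
    pullback_linear : linear f;
    pullback1 : f 1 = 1;
    pullbackM : forall a b, f (a * b) = f a * f b;
    pullback_bidegree : has_bidegree (@homog R X) (@homog R Y) 0 0 f;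
    pullback_exd : forall a, f (exd a) = exd (f a) }.

Definition nondegenerate (R : realType) (X : calculus R) (s : int) (w : X) :
    Prop :=
  forall l b, homog 1 l b ->
  exists! i : X -> X, vector_field (l - s) i /\ i w = b.

(* h = {f, g} for the symplectic form w of internal degree s, where f has
   degree l: contraction of dg with the Hamiltonian vector field of f. *)
Definition is_poisson_bracket (R : realType) (X : calculus R) (s : int) (w : X)
    (l : int) (f g h : X) : Prop :=
  exists i : X -> X,
    [/\ vector_field (l - s) i, i w = exd f & h = i (exd g)].

(* Exact Hamiltonian dg symplectic target of AKSZ degree n - 1. *)
Record target (R : realType) (n : nat) := Target {
  target_calculus :> calculus R;
  alphaY : target_calculus;
  omegaY : target_calculus;
  iQY : target_calculus -> target_calculus;
  ThetaY : target_calculus;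
  alphaY_homog : homog 1 (n%:Z - 1) alphaY;
  omegaY_homog : homog 2 (n%:Z - 1) omegaY;
  omegaY_exact : omegaY = exd alphaY;
  omegaY_nondegenerate : nondegenerate (n%:Z - 1) omegaY;
  iQY_cohomological : cohomological iQY;
  ThetaY_homog : homog 0 n%:Z ThetaY;
  iQY_hamiltonian : iQY omegaY = exd ThetaY;
  ThetaY_master : is_poisson_bracket (n%:Z - 1) omegaY n%:Z ThetaY ThetaY 0 }.

(* Calculus of a product of a field space with a source T[1]G.  The form
   degree p splits as (p - b) + b, where b is the form degree along the source
   factor (recorded by src_forms b), and exd splits as delta + (source part),
   where delta is the de Rham differential along the field space. *)
Record product_calculus (R : realType) := ProductCalculus {
  product_forms :> calculus R;
  src_forms : int -> set product_forms;
  fdelta : product_forms -> product_forms;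
  src_subspace : forall b, subspace (src_forms b);
  src_direct : forall p j a, homog p j a ->
    exists! c : int -> product_forms,
    [/\ forall b, homog p j (c b) /\ src_forms b (c b),
        forall b, c b != 0 -> 0 <= b <= p,
        finite_set [set b | c b != 0] & a = \sum_(b \in [set: int]) c b];
  srcM : forall b b' a a', src_forms b a -> src_forms b' a' ->
    src_forms (b + b') (a * a');
  fdelta_derivation : is_derivation (@homog R product_forms) 1 fdelta;
  fdelta_bidegree :
    has_bidegree (@homog R product_forms) (@homog R product_forms) 1 0 fdelta;
  fdelta_src : forall b a, src_forms b a -> src_forms b (fdelta a);
  exd_src : forall b a, src_forms b a -> src_forms (b + 1) (exd a - fdelta a) }.

Record is_product_pullback (R : realType) (X Y : product_calculus R)
    (f : X -> Y) : Prop := IsProductPullback {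
  product_pullback : is_pullback f;
  product_pullback_src : forall b a, src_forms b a -> src_forms b (f a);
  product_pullback_fdelta : forall a, f (fdelta a) = fdelta (f a) }.

(* The formal mapping-space hypothesis for F |-> Map(T[1]F, Y). *)
Record mapping_spaces (R : realType) (n : nat) (M : manifold_with_faces R n)
    (o : face_orientations M) (Y : target R n) := MappingSpaces {
  (* forms on the mapping space of F, and on its product with T[1]G *)
  fields : faces M -> calculus R;
  prod_forms : faces M -> faces M -> product_calculus R;
  (* pullbacks along the evaluation map of F, along the restriction of maps
     from F to G, along (restriction) x id_T[1]G, and along id x (inclusion
     of T[1]G into T[1]F) *)
  ev : forall F, Y -> prod_forms F F;
  rho : forall F G, fields G -> fields F;
  rho_id : forall F G, prod_forms G G -> prod_forms F G;
  restr : forall F G, prod_forms F F -> prod_forms F G;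
  (* Berezin integration over T[1]G *)
  fiber_int : forall F G, prod_forms F G -> fields F;
  (* contractions by the lifts of the source vector field D_F and of the target
     vector field Q to the mapping space, by the same vector fields on the
     product with T[1]F, and by D_F itself on that product *)
  iDhat : forall F, fields F -> fields F;
  iQhat : forall F, fields F -> fields F;
  iDhat_prod : forall F, prod_forms F F -> prod_forms F F;
  iQhat_prod : forall F, prod_forms F F -> prod_forms F F;
  iD : forall F, prod_forms F F -> prod_forms F F;
  ev_pullback : forall F, is_pullback (@ev F);
  rho_pullback : forall F G, subface G F -> is_pullback (@rho F G);
  rho_comp : forall F G H, subface G F -> subface H G ->
    forall a : fields H, rho F (rho G a) = rho F a;
  rho_id_pullback : forall F G, subface G F ->
    is_product_pullback (@rho_id F G);
  restr_pullback : forall F G, subface G F -> is_product_pullback (@restr F G);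
  restr_ev : forall F G, subface G F ->
    forall x, restr G (ev F x) = rho_id F (ev G x);
  fiber_int_linear : forall F G, linear (@fiber_int F G);
  fiber_int_degree : forall F G p j (a : prod_forms F G), homog p j a ->
    src_forms 0 a -> homog p (j - (dim G)%:Z) (fiber_int a);
  fiber_int_src : forall F G b (a : prod_forms F G), b != 0 ->
    src_forms b a -> fiber_int a = 0;
  fiber_int_delta : forall F G (a : prod_forms F G),
    exd (fiber_int a) = (-1) ^+ dim G *: fiber_int (fdelta a);
  fiber_int_base_change : forall F G, subface G F ->
    forall a : prod_forms G G, fiber_int (rho_id F a) = rho F (fiber_int a);
  iDhat_cohomological : forall F, cohomological (@iDhat F);
  iQhat_cohomological : forall F, cohomological (@iQhat F);
  iDhat_prod_cohomological : forall F, cohomological (@iDhat_prod F);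
  iQhat_prod_cohomological : forall F, cohomological (@iQhat_prod F);
  iD_cohomological : forall F, cohomological (@iD F);
  (* D_F is vertical; the other two fields are horizontal *)
  iD_src : forall F b a, src_forms b a -> src_forms (b - 1) (@iD F a);
  iDhat_src : forall F b a, src_forms b a -> src_forms b (@iDhat_prod F a);
  iQhat_src : forall F b a, src_forms b a -> src_forms b (@iQhat_prod F a);
  (* the source de Rham differential is the Lie derivative along D_F *)
  source_d_delta : forall F a,
    lie 1 (@iD F) (fdelta a) = - fdelta (lie 1 (@iD F) a);
  iDhat_fiber_int : forall F (a : prod_forms F F),
    iDhat (fiber_int a) = fiber_int (iDhat_prod a);
  iQhat_fiber_int : forall F (a : prod_forms F F),
    iQhat (fiber_int a) = fiber_int (iQhat_prod a);
  iDhat_rho : forall F G, subface G F ->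
    forall a : fields G, iDhat (rho F a) = rho F (iDhat a);
  iQhat_rho : forall F G, subface G F ->
    forall a : fields G, iQhat (rho F a) = rho F (iQhat a);
  (* the lift by precomposition and D_F have the same image under the
     differential of the evaluation map; the lift of Q is ev-related to Q *)
  iDhat_ev : forall F x, iDhat_prod (ev F x) = iD (ev F x);
  iQhat_ev : forall F x, iQhat_prod (ev F x) = ev F (iQY x);
  stokes : forall F (a : prod_forms F F),
    fiber_int (lie 1 (@iD F) a) =
    \sum_(G \in [set G | facet G F]) incidence o F G *: fiber_int (restr G a) }.

Arguments ev {R n M o Y} S F _ : rename.
Arguments rho {R n M o Y} S F {G} _ : rename.
Arguments iDhat {R n M o Y} S F _ : rename.

Section FaceComplex.
Context {R : realType} {n : nat} {M : manifold_with_faces R n}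
  {o : face_orientations M} {Y : target R n} (S : mapping_spaces o Y).

Definition transgression (k : nat) (F : faces M) (x : Y) : fields S F :=
  iter k (iDhat S F) (fiber_int (ev S F x)).

Definition face_family := forall F : faces M, nat -> fields S F.

Definition cochains (p : int) (eta : face_family) : Prop :=
  forall F k, pforms (p - k%:Z) (eta F k).

Definition bigD (eta : face_family) : face_family := fun F k =>
  (-1) ^+ dim F *: exd (eta F k) +
  (if k is k'.+1 then
     \sum_(G \in [set G | facet G F]) incidence o F G *: rho S F (eta G k')
   else 0).

Definition bigT (x : Y) : face_family := fun F k =>
  (k`!%:R : R)^-1 *: transgression k F x.

End FaceComplex.

Arguments face_family {R n M o Y} S.
Arguments cochains {R n M o Y} S p eta.
Arguments bigD {R n M o Y} S eta F k.
Arguments bigT {R n M o Y} S x F k.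

(* Main.v *)
(* Every point has a chart in which the faces near it are coordinate pieces
   {y | the vanishing nonnegative coordinates of y are exactly those in A};
   embeddedness of the hypersurfaces makes A (the index of the face at that
   point) unique.  Hence, for H of codimension two in F, there are exactly two
   faces G between F and H, with indices Z - i and Z - j.  The sign [F:G] does
   not depend on the point, chart, frame or outward vector used to compute it;
   computing [F:G][G:H] near a point of H by the frames (-e_j, -e_i, w) and
   (-e_i, -e_j, w) shows that the two products are opposite, and this gives
   D^2 = 0.

   For the cochain map, let L = [iota, delta] with iota the contraction with
   the lifted source field.  Since [iota, L] = 0, iota^k delta = delta iota^k +
   k iota^(k-1) L, and Stokes' formula identifies L on the degree-zero
   transgression with the sum over the facets; k/k! = 1/(k-1)! does the rest. *)
Require Import Defs.
From HB Require Import structures.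
From mathcomp Require Import all_boot all_order all_algebra.
From mathcomp Require perm.
From mathcomp Require Import finmap.
From mathcomp Require Import all_classical all_reals all_analysis.

Set Implicit Arguments.
Unset Strict Implicit.
Unset Printing Implicit Defensive.

Import Order.TTheory GRing.Theory Num.Theory.
Import numFieldNormedType.Exports.

Local Open Scope classical_set_scope.
Local Open Scope ring_scope.

(** * Charts and coordinate changes *)

(** For [Z] the vanishing coordinates at a point, this is the tangent cone of the corner there: the
    velocities of rays that stay in the model for a short time. *)
Definition cone (R : realType) (n : nat) (Z : {set 'I_n}) (u : 'rV[R]_n) :=
  forall i, i \in Z -> 0 <= u ord0 i.

Section Charts.
Context {R : realType} {n : nat} {X : topologicalType}.
Implicit Types (c : chart R n X) (x y : X).

Local Notation r := chart_rank.
Local Notation phi := chart_coord.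

Lemma chart_coord_model c x : is_chart c -> chart_dom c x ->
  corner_model R n (r c) (phi c x).
Proof.
case=> _ oD _ _ /(_ _ oD (@subset_refl _ _))[W oW WE] Dx.
by have [] : (W `&` corner_model R n (r c)) (phi c x) by rewrite -WE; exists x.
Qed.

Lemma near_chart_dom c x : is_chart c -> chart_dom c x ->
  \forall y \near x, chart_dom c y.
Proof. by case=> _ oD _ _ _ Dx; exact: open_nbhs_nbhs. Qed.

Lemma near_chart_coord c x (P : set 'rV[R]_n) : is_chart c -> chart_dom c x ->
  nbhs (phi c x) P -> \forall y \near x, P (phi c y).
Proof. by case=> _ _ cc _ _ Dx; exact: cc. Qed.

(** A chart is an open map onto the relatively open part of the model that it covers. This lifts
    rays and segments drawn in coordinates back to points of the space. *)
Lemma chart_box c x (N : set X) : is_chart c -> chart_dom c x -> nbhs x N ->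
  \forall q \near phi c x, corner_model R n (r c) q ->
    exists y, [/\ N y, chart_dom c y & phi c y = q].
Proof.
move=> cP Dx Nx; have [_ oD _ _ img] := cP.
have oV : open (N° `&` chart_dom c) by apply: openI => //; exact: open_interior.
have [|W oW WE] := img _ oV; first by move=> ? [].
have Wx : W (phi c x).
  have : (W `&` corner_model R n (r c)) (phi c x).
    by rewrite -WE; exists x => //; split=> //; exact: nbhs_singleton (nbhs_interior Nx).
  by case.
near=> q => mq.
have : (W `&` corner_model R n (r c)) q.
  by split=> //; near: q; exact: open_nbhs_nbhs.
rewrite -WE => -[y [Ny Dy] <-]; exists y; split=> //; exact: interior_subset.
Unshelve. all: end_near. Qed.

Lemma mem_boundary_coords c x i :
  (i \in boundary_coords c x) = (i < r c)%N && (phi c x ord0 i == 0).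
Proof. by rewrite /boundary_coords inE. Qed.

Lemma near_coord (p : 'rV[R]_n) i (P : set R) : open P -> P (p ord0 i) ->
  \forall q \near p, P ((q : 'rV[R]_n) ord0 i).
Proof. by move=> oP Pp; apply: (@coord_continuous R 1 n ord0 i p P); exact: open_nbhs_nbhs. Qed.

(** Nonvanishing of a coordinate is an open condition, so nearby points can only lose boundary
    coordinates. *)
Lemma near_boundary_coords c x : is_chart c -> chart_dom c x ->
  \forall y \near x, boundary_coords c y \subset boundary_coords c x.
Proof.
move=> cP Dx.
suff : \forall y \near x, forall i, i \notin boundary_coords c x ->
    i \notin boundary_coords c y.
  by apply: filterS => y H; apply/fintype.subsetP => i; apply: contraTT; exact: H.
apply: filter_forall => i.
have [ix|ix] := boolP (i \in boundary_coords c x); first exact: nearW.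
move: ix; rewrite mem_boundary_coords negb_and.
case/orP => [ir|px]; first by apply: nearW => y; rewrite mem_boundary_coords (negbTE ir).
have H := near_coord (@open_neq R 0) px.
have := near_chart_coord cP Dx H.
by apply: filterS => y py _; rewrite mem_boundary_coords negb_and py orbT.
Qed.

Lemma cvg_ray (p u : 'rV[R]_n) : (p + t *: u) @[t --> (0:R)^'+] --> p.
Proof.
apply: cvg_at_right_filter; rewrite -[X in _ --> X]addr0 -(scale0r u).
by apply: cvgD; [exact: cvg_cst|apply: cvgZr_tmp; exact: cvg_id].
Qed.

Lemma cone_model c x u : is_chart c -> chart_dom c x ->
  cone (boundary_coords c x) u ->
  \forall t \near (0:R)^'+, corner_model R n (r c) (phi c x + t *: u).
Proof.
move=> cP Dx uK; apply: filter_forall => i.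
have mx := chart_coord_model cP Dx.
have [ir|ir] := boolP (i < r c)%N; last by apply: nearW.
have [p0|p0] := eqVneq (phi c x ord0 i) 0.
  have u0 : 0 <= u ord0 i by apply: uK; rewrite mem_boundary_coords ir p0 eqxx.
  near=> t => _; rewrite !mxE p0 add0r mulr_ge0//.
have pp : 0 < phi c x ord0 i by rewrite lt_neqAle eq_sym p0 mx.
have H := @cvg_ray (phi c x) u _ (near_coord (@open_gt R 0) pp).
by near=> t => _; apply: ltW; near: t; exact: H.
Unshelve. all: end_near. Qed.

(** At a corner only one-sided rays stay in the model. They still pass through actual points of the
    space, which is what makes one-sided derivatives of coordinate changes computable. *)
Lemma near_ray c x u (P : set X) : is_chart c -> chart_dom c x ->
  cone (boundary_coords c x) u -> nbhs x P ->
  \forall t \near (0:R)^'+, exists y,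
    [/\ P y, chart_dom c y & phi c y = phi c x + t *: u].
Proof.
move=> cP Dx uK Px.
have := @cvg_ray (phi c x) u _ (chart_box cP Dx Px); apply: filterS2 (cone_model cP Dx uK).
by move=> t mt /(_ mt).
Qed.

Lemma piece_adherent c x (A : {set 'I_n}) (N : set X) : is_chart c ->
  chart_dom c x -> A \subset boundary_coords c x -> nbhs x N ->
  exists y, [/\ N y, chart_dom c y & boundary_coords c y = A].
Proof.
move=> cP Dx /fintype.subsetP AZ Nx.
(* Moving along [u] makes exactly the coordinates outside [A] positive and leaves those in [A] at
   zero. *)
pose u : 'rV[R]_n := \row_i (if i \in boundary_coords c x :\: A then 1 else 0).
have uK : cone (boundary_coords c x) u.
  by move=> i _; rewrite mxE; case: ifP.
have [t [[y [[Ny yx] Dy yE]] t0]] : exists t, (exists y,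
    [/\ N y /\ boundary_coords c y \subset boundary_coords c x, chart_dom c y &
        phi c y = phi c x + t *: u]) /\ 0 < t.
  apply: (@filter_ex _ (0:R)^'+).
  apply: filterI; last exact: nbhs_right_gt.
  apply: near_ray => //; exact: filterI (near_boundary_coords cP Dx).
exists y; split=> //; apply/finset.setP => i.
move/fintype.subsetP/(_ i): yx; move: (AZ i); have := uK i.
rewrite !mem_boundary_coords yE !mxE !inE.
case: (i \in A) => /=.
  by move=> _ /(_ isT)/andP[-> /eqP->] _; rewrite mulr0 addr0 eqxx.
case: (i < r c)%N => //= _ _.
have [->|_] := eqVneq (phi c x ord0 i) 0 => /= H.
  by rewrite mulr1 add0r (gt_eqF t0).
by apply/negP => /H.
Qed.

(** Balls and the corner model are convex, and along a segment between two model points with the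
    same vanishing coordinates the vanishing coordinates do not change. The connecting set is the
    lift of this segment. *)
Lemma local_piece c x : is_chart c -> chart_dom c x ->
  exists2 U, nbhs x U & forall y z, U y -> U z ->
    boundary_coords c y = boundary_coords c z ->
    exists C, [/\ connected C, C y, C z &
      C `<=` [set v | chart_dom c v /\ boundary_coords c v = boundary_coords c y]].
Proof.
move=> cP Dx; have [_ _ _ inj _] := cP.
have [e /= e0 eB] := (nbhs_ballP _ _).1 (@chart_box c x setT cP Dx filterT).
exists (chart_dom c `&` [set y | ball (phi c x) e (phi c y)]).
  apply: filterI; first exact: near_chart_dom.
  by apply: near_chart_coord => //; exact: nbhsx_ballx.
move=> y z [Dy By] [Dz Bz] yz.
pose seg (t : R) := phi c y + t *: (phi c z - phi c y).
have segE t : seg t = (1 - t) *: phi c y + t *: phi c z.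
  by rewrite /seg scalerBl scalerBr scale1r addrA addrAC.
have segB t : 0 <= t <= 1 -> ball (phi c x) e (seg t).
  case/andP=> t0 t1.
  move: By Bz; rewrite -!ball_normE /= => By Bz.
  have -> : phi c x - seg t = (1 - t) *: (phi c x - phi c y) + t *: (phi c x - phi c z).
    by rewrite segE !scalerBr addrACA -scalerDl subrK scale1r opprD.
  apply: le_lt_trans (ler_normD _ _) _.
  rewrite !normrZ (ger0_norm t0) ger0_norm ?subr_ge0//.
  have -> : e = (1 - t) * e + t * e by rewrite -mulrDl subrK mul1r.
  move: t0; rewrite le_eqVlt => /predU1P[<-|t0].
    by rewrite subr0 !mul1r !mul0r !addr0.
  by apply: ler_ltD; [rewrite ler_wpM2l ?subr_ge0// ltW|rewrite ltr_pM2l].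
have my := chart_coord_model cP Dy; have mz := chart_coord_model cP Dz.
have segM t : 0 <= t <= 1 -> corner_model R n (r c) (seg t).
  case/andP=> t0 t1 i ir.
  by rewrite segE !mxE addr_ge0// mulr_ge0 ?subr_ge0//; [exact: my|exact: mz].
have gex t : exists v, 0 <= t <= 1 -> chart_dom c v /\ phi c v = seg t.
  have [ti|ti] := pselect (0 <= t <= 1); last by exists x.
  by have [//||v [_ ? ?]] := eB (seg t); [exact: segB|exact: segM|exists v].
have [g gP] := choice gex.
have g0 : g 0 = y.
  have [|D E] := gP 0; first by rewrite lexx ler01.
  by apply: inj => //; rewrite E /seg scale0r addr0.
have g1 : g 1 = z.
  have [|D E] := gP 1; first by rewrite lexx ler01.
  by apply: inj => //; rewrite E /seg scale1r addrC subrK.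
exists (g @` `[0, 1]); split.
- apply: connected_continuous_connected; first exact: segment_connected.
  apply/subspace_continuousP => t; rewrite /= in_itv => ti N Nt.
  have [Dt Et] := gP t ti.
  have segc : {for t, continuous seg}.
    apply: cvgD; [exact: cvg_cst|apply: cvgZr_tmp; exact: cvg_id].
  (* The lift [g] is chosen pointwise. It is continuous because openness of the chart puts a point
     near [g t] over [seg s], and injectivity identifies that point with [g s]. *)
  have H : \forall s \near t, corner_model R n (r c) (seg s) ->
      exists v, [/\ N v, chart_dom c v & phi c v = seg s].
    by apply: (segc (fun q => corner_model R n (r c) q ->
      exists v, [/\ N v, chart_dom c v & phi c v = q])); rewrite -Et; exact: chart_box.
  change (nbhs t [set s | `[0, 1]%classic s -> N (g s)]); near=> s => /=.
  rewrite in_itv => si.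
  have : corner_model R n (r c) (seg s) -> exists y0, [/\ N y0, chart_dom c y0 & phi c y0 = seg s].
    by near: s; exact: H.
  move=> /(_ (segM s si))[v [Nv Dv vE]].
  have [Ds Es] := gP s si.
  by rewrite /= (inj (g s) v)// Es.
- by exists 0 => //=; rewrite in_itv /= lexx ler01.
- by exists 1 => //=; rewrite in_itv /= lexx ler01.
- move=> _ [t + <-]; rewrite /= in_itv => ti; have [Dt Et] := gP t ti; split=> //.
  apply/finset.setP => i; move/finset.setP/(_ i): yz.
  rewrite !mem_boundary_coords Et segE !mxE.
  have [ir|//] := boolP (i < r c)%N => /=.
  have := my i ir; have := mz i ir; move: ti => /andP[t0 t1].
  move: (phi c y ord0 i) (phi c z ord0 i) => a b b0 a0.
  have [->|an] := eqVneq a 0; have [->|bn] // := eqVneq b 0.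
    by rewrite !mulr0 addr0 eqxx.
  move=> _; apply/eqP => /eqP; rewrite paddr_eq0 ?mulr_ge0 ?subr_ge0//.
  by rewrite !mulf_eq0 (negbTE an) (negbTE bn) !orbF subr_eq0 => /andP[/eqP<-]; rewrite oner_eq0.
Unshelve. all: end_near. Qed.
End Charts.

(** * Entrywise limits of matrices and determinants *)

Section Limits.
Context {R : realType} {T : Type} {F : set_system T} {FF : ProperFilter F}.

Lemma cvg_mulmx m n p (A : T -> 'M[R]_(m, n)) (A0 : 'M[R]_(m, n)) (B : 'M[R]_(n, p)) :
  (forall i j, A t i j @[t --> F] --> A0 i j) ->
  forall i j, (A t *m B) i j @[t --> F] --> (A0 *m B) i j.
Proof.
move=> AA i j; rewrite mxE; under eq_fun do rewrite mxE.
apply: cvg_big; first exact: add_continuous.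
by move=> k _; apply: cvgM; [exact: AA|exact: cvg_cst].
Qed.

Lemma cvg_mulmxr m n p (B : 'M[R]_(p, m)) (A : T -> 'M[R]_(m, n)) (A0 : 'M[R]_(m, n)) :
  (forall i j, A t i j @[t --> F] --> A0 i j) ->
  forall i j, (B *m A t) i j @[t --> F] --> (B *m A0) i j.
Proof.
move=> AA i j; rewrite mxE; under eq_fun do rewrite mxE.
apply: cvg_big; first exact: add_continuous.
by move=> k _; apply: cvgM; [exact: cvg_cst|exact: AA].
Qed.

Lemma cvg_det m (A : T -> 'M[R]_m) (A0 : 'M[R]_m) :
  (forall i j, A t i j @[t --> F] --> A0 i j) ->
  \det (A t) @[t --> F] --> \det A0.
Proof.
move=> AA; apply: cvg_big; first exact: add_continuous.
move=> s _; apply: cvgM; first exact: cvg_cst.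
by apply: cvg_big; [exact: mul_continuous|move=> i _; exact: AA].
Qed.

Lemma cvg_ge0 (f : T -> R) (l : R) : f t @[t --> F] --> l ->
  (\forall t \near F, 0 <= f t) -> 0 <= l.
Proof. by move=> fl f0; rewrite -(cvg_lim _ fl)//; apply: limr_ge => //; apply/cvg_ex; exists l. Qed.

Lemma near_cvg_cst (f : T -> R) (l a : R) : f t @[t --> F] --> l ->
  (\forall t \near F, f t = a) -> l = a.
Proof.
move=> fl fa; apply: (cvg_unique _ fl) => //.
by apply: cvg_near_cst.
Qed.

End Limits.

(** * Derivatives of coordinate changes at corner points *)

Section Transitions.
Context {R : realType} {n : nat}.

Lemma differentiable_ray (f : 'rV[R]_n -> 'rV[R]_n) (p v : 'rV[R]_n) : differentiable f p ->
  forall j, (t^-1 *: (f (p + t *: v) - f p)) ord0 j @[t --> 0^'+] --> (v *m 'J f p) ord0 j.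
Proof.
move=> df j; have dv := @diff_derivable _ _ _ f p v df.
have H : h^-1 *: ((f \o shift p) (h *: v) - f p) @[h --> 0^'] --> v *m 'J f p.
  by rewrite -deriveEjacobian//; exact: dv.
have H2 : h^-1 *: ((f \o shift p) (h *: v) - f p) @[h --> 0^'+] --> v *m 'J f p.
  exact: cvg_dnbhs_at_right H.
rewrite (_ : (fun t => _) = (fun M : 'rV[R]_n => M ord0 j) \o
    (fun h => h^-1 *: ((f \o shift p) (h *: v) - f p))).
  exact: cvg_comp _ _ H2 (@coord_continuous R 1 n ord0 j _).
by apply/funext => t /=; rewrite [p + _]addrC.
Qed.

Lemma mul_jacobian (f : 'rV[R]_n -> 'rV[R]_n) (p v : 'rV[R]_n) :
  differentiable f p -> v *m 'J f p = 'd f p v.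
Proof. by move=> df; rewrite -deriveEjacobian// deriveE. Qed.

(** The entries of the Jacobian are first partial derivatives, which are themselves differentiable
    and therefore continuous. *)
Lemma smooth_near_cvg (f : 'rV[R]_n -> 'rV[R]_n) (p : 'rV[R]_n) : smooth_near p f ->
  forall i j, 'J f q i j @[q --> p] --> 'J f p i j.
Proof.
move=> sf i j.
have d1 : \forall q \near p, differentiable f q by apply: filterS sf => q /(_ [::]).
have E q : differentiable f q -> 'J f q i j = 'D_(delta_mx ord0 i) f q ord0 j.
  by move=> /deriveE ->; rewrite mxE.
have dp := nbhs_singleton d1.
have /(_ [:: i])/= /differentiable_continuous dc := nbhs_singleton sf.
have H : (fun M : 'rV[R]_n => M ord0 j) \o (fun q => 'D_(delta_mx ord0 i) f q) @ p -->
    'D_(delta_mx ord0 i) f p ord0 j.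
  exact: cvg_comp _ _ dc (@coord_continuous R 1 n ord0 j _).
rewrite -(E _ dp) in H.
have H2 : \forall q \near p, 'D_(delta_mx ord0 i) f q ord0 j = 'J f q i j.
  by apply: filterS d1 => q dq; exact: esym (E _ dq).
exact: cvg_trans (near_eq_cvg H2) H.
Qed.

Context {X : topologicalType}.
Implicit Types (c : chart R n X) (x y : X).

Lemma transition_coord c c' x f : is_transition c c' x f ->
  f (chart_coord c x) = chart_coord c' x.
Proof. by case=> _ /nbhs_singleton. Qed.

Lemma transition_differentiable c c' x f : is_transition c c' x f ->
  differentiable f (chart_coord c x).
Proof. by case=> /nbhs_singleton/(_ [::]). Qed.

Lemma near_transition c c' x f : is_chart c -> chart_dom c x ->
  is_transition c c' x f -> \forall y \near x, is_transition c c' y f.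
Proof.
move=> cP Dx [sf tf]; apply: filterI; last exact: near_join.
exact: (near_chart_coord cP Dx (near_join sf)).
Qed.

Lemma near_jacobian_cvg c c' x f : is_chart c -> chart_dom c x ->
  is_transition c c' x f -> forall i j,
  'J f (chart_coord c y) i j @[y --> x] --> 'J f (chart_coord c x) i j.
Proof.
move=> cP Dx [sf _] i j; have [_ _ /(_ _ Dx) cc _ _] := cP.
exact: (cvg_comp _ _ cc (@smooth_near_cvg _ _ sf i j)).
Qed.

(** A coordinate of [c'] that vanishes at [x] is nonnegative along a ray inside the model, so its
    difference quotients are nonnegative, and so is their limit. *)
Lemma transition_cone c c' x f u : is_chart c -> is_chart c' ->
  chart_dom c x -> chart_dom c' x -> is_transition c c' x f ->
  cone (boundary_coords c x) u ->
  cone (boundary_coords c' x) (u *m 'J f (chart_coord c x)).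
Proof.
move=> cP cP' Dx Dx' fT uK i; rewrite mem_boundary_coords => /andP[ir /eqP p0].
have := @differentiable_ray _ _ u (transition_differentiable fT) i.
move=> /cvg_ge0; apply.
have H := near_ray cP Dx uK (@filterI _ _ (nbhs_filter x) _ _ fT.2 (near_chart_dom cP' Dx')).
near=> t; have t0 : 0 < t by near: t; exact: nbhs_right_gt.
have [//|y [[fy Dy'] Dy yE]] := near H t.
rewrite -yE fy (transition_coord fT) !mxE p0 subr0.
rewrite mulr_ge0 ?invr_ge0 ?(ltW t0)//.
exact: chart_coord_model.
Unshelve. all: end_near. Qed.

(** The composite [g \o f] is known to be the identity only on the model, not on a full
    neighbourhood. The coordinate vectors lie in the cone, however, and one-sided derivatives along
    them determine the whole Jacobian. *)
Lemma transition_inverse c c' x f g : is_chart c -> is_chart c' ->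
  chart_dom c x -> chart_dom c' x ->
  is_transition c c' x f -> is_transition c' c x g ->
  'J f (chart_coord c x) *m 'J g (chart_coord c' x) = 1%:M.
Proof.
move=> cP cP' Dx Dx' fT gT; apply/row_matrixP => i.
have fd := transition_differentiable fT.
have gd : differentiable g (f (chart_coord c x)).
  by rewrite (transition_coord fT); exact: (transition_differentiable gT).
have d := differentiable_comp fd gd.
pose u : 'rV[R]_n := delta_mx ord0 i.
have uK : cone (boundary_coords c x) u by move=> j _; rewrite mxE; case: (_ && _).
have -> : row i ('J f (chart_coord c x) *m 'J g (chart_coord c' x)) =
    u *m 'J (g \o f) (chart_coord c x).
  rewrite rowE mulmxA -(transition_coord fT).
  apply: etrans (mul_jacobian _ gd) _; apply: etrans (esym (mul_jacobian _ d)).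
  apply: etrans (congr1 (fun w => 'd g (f (chart_coord c x)) w) (mul_jacobian u fd)) _.
  exact: (congr1 (fun h : 'rV[R]_n -> 'rV[R]_n => h u) (esym (diff_comp fd gd))).
rewrite row1 -/u; apply/rowP => j.
apply: (near_cvg_cst (@differentiable_ray _ _ u d j)).
have H := near_ray cP Dx uK (@filterI _ _ (nbhs_filter x) _ _ fT.2 gT.2).
near=> t; have t0 : t != 0 by near: t; exact: nbhs_right_neq.
have [//|y [[fy gy] Dy yE]] /= := near H t.
rewrite -yE fy gy (transition_coord fT) (transition_coord gT) yE addrC addKr.
by rewrite scalerA mulVf// scale1r.
Unshelve. all: end_near. Qed.

End Transitions.

(** * Frames of coordinate subspaces *)

Section Tangent.
Context {R : realType} {n : nat}.
Implicit Types Z : {set 'I_n}.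

Definition coord_frame Z : 'M[R]_(#|~: Z|, n) :=
  \matrix_(a, i) (i == enum_val a)%:R.

Lemma coord_frame_tangent Z : rows_tangent Z (coord_frame Z).
Proof.
move=> a i iZ; rewrite mxE; case: eqP => // ia.
by have := enum_valP a; rewrite -ia inE iZ.
Qed.

Lemma coord_frame_mul m Z (u : 'M[R]_(m, n)) : rows_tangent Z u ->
  u = u *m (coord_frame Z)^T *m coord_frame Z.
Proof.
move=> uZ; apply/matrixP => a i; rewrite mxE.
have uE b : (u *m (coord_frame Z)^T) a b = u a (enum_val b).
  rewrite mxE (bigD1 (enum_val b))//= !mxE eqxx mulr1 big1 ?addr0// => j /negbTE jb.
  by rewrite !mxE jb mulr0.
under eq_bigr do rewrite uE mxE.
have [iZ|iZ] := boolP (i \in Z).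
  rewrite uZ// big1// => b _; case: eqP => [ib|_]; last by rewrite mulr0.
  by have := enum_valP b; rewrite -ib inE iZ.
have iC : i \in ~: Z by rewrite inE.
rewrite (bigD1 (enum_rank_in iC i))//= enum_rankK_in// eqxx mulr1 big1 ?addr0// => b bi.
case: eqP => [ib|_]; last by rewrite mulr0.
by case/eqP: bi; apply: enum_val_inj; rewrite enum_rankK_in.
Qed.

Lemma coord_frame_free Z : row_free (coord_frame Z).
Proof.
apply/row_freeP; exists (coord_frame Z)^T; apply/matrixP => a b.
rewrite !mxE (bigD1 (enum_val a))//= !mxE eqxx mul1r big1.
  by rewrite addr0 (inj_eq enum_val_inj).
by move=> j /negbTE ja; rewrite !mxE ja mul0r.
Qed.

Lemma tangent_sub_frame m Z (u : 'M[R]_(m, n)) : rows_tangent Z u ->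
  (u <= coord_frame Z)%MS.
Proof. by move/coord_frame_mul ->; exact: submxMl. Qed.

Lemma tangent_rank m Z (u : 'M[R]_(m, n)) : rows_tangent Z u ->
  (\rank u + #|Z| <= n)%N.
Proof.
move=> /tangent_sub_frame/mxrankS; have := coord_frame_free Z.
rewrite /row_free => /eqP -> rk.
by rewrite -[X in (_ <= X)%N](card_ord n) -(cardsC Z) addnC leq_add2l.
Qed.

(** The independent rows of [w] are as many as the dimension of the coordinate subspace, so they
    span it. *)
Lemma tangent_submx m m' Z (w : 'M[R]_(m, n)) (u : 'M[R]_(m', n)) :
  row_free w -> rows_tangent Z w -> (m + #|Z|)%N = n -> rows_tangent Z u ->
  (u <= w)%MS.
Proof.
move=> wf wZ mZ uZ; apply: submx_trans (tangent_sub_frame uZ) _.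
have := coord_frame_free Z; move: wf; rewrite /row_free => /eqP rw /eqP rc.
have [_ ] := mxrank_leqif_eq (tangent_sub_frame wZ).
rewrite rw rc => H; have : m == #|~: Z|.
  by rewrite -(eqn_add2r #|Z|) mZ addnC cardsC card_ord.
by rewrite H => /andP[].
Qed.

Lemma rows_tangent_col_mx m Z (v : 'rV[R]_n) (w : 'M[R]_(m, n)) :
  rows_tangent Z v -> rows_tangent Z w -> rows_tangent Z (col_mx v w).
Proof.
by move=> vZ wZ a i iZ; rewrite mxE; case: splitP => b _; [exact: vZ|exact: wZ].
Qed.

Lemma rows_tangentS m Z Z' (w : 'M[R]_(m, n)) : Z' \subset Z ->
  rows_tangent Z w -> rows_tangent Z' w.
Proof. by move=> /fintype.subsetP ZZ wZ a i /ZZ; exact: wZ. Qed.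

Lemma row_free_outward m Z i (v : 'rV[R]_n) (w : 'M[R]_(m, n)) :
  i \in Z -> v ord0 i != 0 -> row_free w -> rows_tangent Z w ->
  row_free (col_mx v w).
Proof.
move=> iZ vi wf wZ.
apply/row_freeP; have [D wD] := row_freeP wf.
pose E : 'M[R]_(n, 1) := (v ord0 i)^-1 *: delta_mx i ord0.
have vE : v *m E = 1%:M.
  apply/matrixP => a b; rewrite !ord1 -scalemxAr -colE !mxE eqxx mulr1n.
  by rewrite mulVf.
have wE : w *m E = 0.
  by apply/matrixP => a b; rewrite -scalemxAr -colE !mxE wZ// mulr0.
(* [D] is a right inverse of [w], and [E] reads off the coordinate [i] normalized by [v]; the
   correction makes the second block vanish on [v]. *)
exists (row_mx E (D - E *m (v *m D))).
rewrite mul_col_row vE wE !mulmxBr !mulmxA vE wE !mul0mx !mul1mx subrr subr0 wD.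
by rewrite -scalar_mx_block.
Qed.

End Tangent.

(** * Invariance of tangent spaces and depth under coordinate changes *)

Section TransitionTangent.
Context {R : realType} {n : nat} {X : topologicalType}.
Implicit Types (c : chart R n X) (x : X).

(** The tangent space of the stratum is the largest linear subspace of the cone: a tangent row and
    its opposite are both mapped into the cone. *)
Lemma transition_tangent c c' x f m (w : 'M[R]_(m, n)) : is_chart c ->
  is_chart c' -> chart_dom c x -> chart_dom c' x -> is_transition c c' x f ->
  rows_tangent (boundary_coords c x) w ->
  rows_tangent (boundary_coords c' x) (w *m 'J f (chart_coord c x)).
Proof.
move=> cP cP' Dx Dx' fT wZ a i iZ.
have K1 : cone (boundary_coords c x) (row a w).
  by move=> j jZ; rewrite mxE wZ.
have K2 : cone (boundary_coords c x) (- row a w).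
  by move=> j jZ; rewrite !mxE wZ// oppr0.
have := transition_cone cP cP' Dx Dx' fT K1 iZ.
have := transition_cone cP cP' Dx Dx' fT K2 iZ.
rewrite mulNmx -row_mul !mxE oppr_ge0 => h1 h2.
by apply/eqP; rewrite eq_le h1 h2.
Qed.

(** The Jacobian is invertible and maps one tangent subspace into the other, so the dimensions
    compare. *)
Lemma transition_depth c c' x f g : is_chart c ->
  is_chart c' -> chart_dom c x -> chart_dom c' x -> is_transition c c' x f ->
  is_transition c' c x g -> (#|boundary_coords c' x| <= #|boundary_coords c x|)%N.
Proof.
move=> cP cP' Dx Dx' fT gT; set Z := boundary_coords c x.
have := tangent_rank (transition_tangent cP cP' Dx Dx' fT (@coord_frame_tangent R n Z)).
have /eqP := coord_frame_free (R := R) Z.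
have := transition_inverse cP cP' Dx Dx' fT gT.
move: ('J f _) ('J g _) => J J' JJ rk.
have Jf : row_free J by apply/row_freeP; exists J'.
rewrite mxrankMfree// rk -[X in (_ <= X)%N](card_ord n) -(cardsC Z) addnC.
by rewrite leq_add2r.
Qed.

End TransitionTangent.

(** * Faces *)

Section Faces.
Context {R : realType} {n : nat} {M : manifold_with_corners R n}.
Implicit Types (F G H : faces M) (c : chart R n M) (x y : M).

Lemma stratum_depth k c x : atlas c -> chart_dom c x ->
  stratum M k x <-> #|boundary_coords c x| = k.
Proof.
move=> ac Dx; split=> [[c' [ac' Dx' <-]]|ck]; last by exists c.
have [f fT] := atlas_smooth ac ac' Dx Dx'.
have [g gT] := atlas_smooth ac' ac Dx' Dx.
have cP := atlas_chart ac; have cP' := atlas_chart ac'.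
apply/eqP; rewrite eqn_leq.
by rewrite (transition_depth cP cP' Dx Dx' fT gT) (transition_depth cP' cP Dx' Dx gT fT).
Qed.

Lemma faceP F : exists2 x, stratum M (codim F) x &
  open_face F = connected_component (stratum M (codim F)) x.
Proof. by case: F => kC kCP; have /= := set_mem kCP. Qed.

Lemma face_stratum F : open_face F `<=` stratum M (codim F).
Proof. by have [x _ ->] := faceP F; exact: connected_component_sub. Qed.

Lemma open_face_connected F : connected (open_face F).
Proof. by have [x _ ->] := faceP F; exact: component_connected. Qed.

Lemma open_face_nonempty F : open_face F !=set0.
Proof. by have [x sx ->] := faceP F; exists x; exact: connected_component_refl. Qed.

Lemma connected_sub_face F C y : connected C -> C `<=` stratum M (codim F) ->
  C y -> open_face F y -> C `<=` open_face F.
Proof.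
have [x _ ->] := faceP F => cC CS Cy /same_connected_component ->.
exact: connected_component_max.
Qed.

Lemma face_inj F G y : codim F = codim G -> open_face F y -> open_face G y ->
  F = G.
Proof.
move=> kk Fy Gy.
have e : open_face F = open_face G.
  rewrite eqEsubset; split.
    apply: (connected_sub_face (y:=y)) => //; first exact: open_face_connected.
    by rewrite -kk; exact: face_stratum.
  apply: (connected_sub_face (y:=y)) => //; first exact: open_face_connected.
  by rewrite kk; exact: face_stratum.
by apply: val_inj; move: kk e; rewrite /codim /open_face; case: (val F) (val G) => [? ?] [? ?] /= -> ->.
Qed.

Lemma face_at k x : stratum M k x -> exists F, codim F = k /\ open_face F x.
Proof.
move=> sx.
have FP : (k, connected_component (stratum M k) x) \in faces M.
  by apply/mem_set; exists x.
exists (SigSub FP); split => //; exact: connected_component_refl.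
Qed.

Lemma face_depth F c x : atlas c -> chart_dom c x -> open_face F x ->
  #|boundary_coords c x| = codim F.
Proof. by move=> ac Dx /face_stratum/(stratum_depth _ ac Dx). Qed.

Lemma open_sub_closed_face F : open_face F `<=` closed_face F.
Proof. exact: subset_closure. Qed.

Lemma subfaceP F G : subface G F <-> open_face G `<=` closed_face F.
Proof.
split=> [H|H]; first exact: subset_trans (@open_sub_closed_face _) H.
have E : closed_face F = closure (closed_face F) by apply/closure_id/closed_closure.
by rewrite /subface E; exact: closure_subset.
Qed.

Lemma near_piece F c x : atlas c -> chart_dom c x ->
  exists2 U, nbhs x U & forall y z, U y -> U z -> open_face F y ->
    boundary_coords c y = boundary_coords c z -> open_face F z.
Proof.
move=> ac Dx; have cP := atlas_chart ac.
have [U Ux UP] := local_piece cP Dx.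
exists U => // y z Uy Uz Fy yz.
have [C [cC Cy Cz CS]] := UP _ _ Uy Uz yz.
apply: (connected_sub_face (y:=y) cC _ Cy Fy) => // v /CS[Dv vy].
have [Dy _] := CS y Cy.
by apply/(stratum_depth _ ac Dv); rewrite vy; exact: face_depth Fy.
Qed.

(** A point of [F] close to [x] supplies [A], and the piece with index [A] is connected near [x], so
    it lies in [F]. Only this inclusion is available for manifolds with corners: a face may reach
    [x] along several pieces. *)
Lemma face_local F c x : atlas c -> chart_dom c x -> closed_face F x ->
  exists A : {set 'I_n}, [/\ A \subset boundary_coords c x, #|A| = codim F &
    \forall y \near x, boundary_coords c y = A -> open_face F y].
Proof.
move=> ac Dx Fx; have cP := atlas_chart ac.
have [U Ux UP] := near_piece F ac Dx.
have /Fx[y [Fy [Uy [Dy yx]]]] : nbhs x (U `&` (chart_dom c `&`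
    [set y | boundary_coords c y \subset boundary_coords c x])).
  apply: filterI => //.
  by apply: filterI; [exact: near_chart_dom|exact: near_boundary_coords].
exists (boundary_coords c y); split => //; first exact: face_depth.
by apply: filterS Ux => z Uz zy; exact: (UP y z).
Qed.

Lemma piece_face c x (A : {set 'I_n}) : atlas c -> chart_dom c x ->
  A \subset boundary_coords c x -> exists F, codim F = #|A| /\
    \forall y \near x, boundary_coords c y = A -> open_face F y.
Proof.
move=> ac Dx AZ; have cP := atlas_chart ac.
have [U Ux UP] := local_piece cP Dx.
have [y [Uy Dy yA]] := piece_adherent cP Dx AZ Ux.
have /face_at[F [kF Fy]] : stratum M #|A| y by apply/(stratum_depth _ ac Dy); rewrite yA.
exists F; split => //; apply: filterS Ux => z Uz zA.
have [|C [cC Cy Cz CS]] := UP _ _ Uy Uz; first by rewrite zA.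
apply: (connected_sub_face (y:=y) cC _ Cy Fy) => // v /CS[Dv vy].
by apply/(stratum_depth _ ac Dv); rewrite vy kF yA.
Qed.

Lemma piece_closure F c x (A : {set 'I_n}) : atlas c -> chart_dom c x ->
  (\forall y \near x, boundary_coords c y = A -> open_face F y) ->
  \forall y \near x, A \subset boundary_coords c y -> closed_face F y.
Proof.
move=> ac Dx; have cP := atlas_chart ac.
move=> /near_join; apply: filterS2 (near_chart_dom cP Dx) => y Dy Fy Ay B By.
have [z [[Fz Bz] Dz zA]] := piece_adherent cP Dy Ay (@filterI _ _ (nbhs_filter y) _ _ Fy By).
by exists z; split => //; exact: Fz.
Qed.

(** The part of [open_face H] inside [closed_face F] is closed and, by local pieces, open in the
    connected set [open_face H]. *)
Lemma frontier F H x : open_face H x -> closed_face F x -> subface H F.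
Proof.
move=> Hx Fx; apply/subfaceP.
suff : open_face H `&` closed_face F = open_face H by move=> <- y [].
apply: open_face_connected.
- by exists x.
- exists (\bigcup_(U in [set U | open U /\ open_face H `&` U `<=` closed_face F]) U).
    by apply: bigcup_open => U [].
  rewrite eqEsubset; split=> y [Hy]; last first.
    by case=> U [_ HU] Uy; split=> //; apply: HU.
  move=> Fy; split=> //.
  have [c ac Dy] := atlas_cover y; have cP := atlas_chart ac.
  have [A [Ay _ FA]] := face_local ac Dy Fy.
  have N : \forall z \near y, open_face H z -> closed_face F z.
    near=> z => Hz.
    have Dz : chart_dom c z by near: z; exact: near_chart_dom.
    have zy : boundary_coords c z \subset boundary_coords c y.
      by near: z; exact: near_boundary_coords.
    (* Points of [H] near [y] have the same number of vanishing coordinates as [y], and those are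
       among the ones at [y]; hence they are the same. *)
    have : A \subset boundary_coords c z.
      suff -> : boundary_coords c z = boundary_coords c y by [].
      by apply/eqP; rewrite eqEcard zy (face_depth ac Dz Hz) (face_depth ac Dy Hy) leqnn.
    by near: z; exact: piece_closure FA.
  exists (interior (fun z => open_face H z -> closed_face F z)); last exact: N.
  by split; [exact: open_interior|move=> z [Hz /interior_subset]; apply].
- by exists (closed_face F) => //; exact: closed_closure.
Unshelve. all: end_near. Qed.

End Faces.

(** * The index of a face at a point, under embeddedness *)

Section FaceIndex.
Context {R : realType} {n : nat} {M : manifold_with_faces R n}.
Implicit Types (F G H : faces M) (c : chart R n M) (x y : M) (A B : {set 'I_n}).

(** In contrast with [face_local], the last clause is an equivalence: near [x] the face is one
    single coordinate piece. *)
Definition index_at F c x A : Prop :=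
  [/\ A \subset boundary_coords c x, #|A| = codim F &
      \forall y \near x, open_face F y <-> boundary_coords c y = A].

Lemma piece_closed_face F c x A : atlas c -> chart_dom c x ->
  A \subset boundary_coords c x ->
  (\forall y \near x, boundary_coords c y = A -> open_face F y) -> closed_face F x.
Proof. by move=> ac Dx AZ /(piece_closure ac Dx)/nbhs_singleton; apply. Qed.

(** Embeddedness supplies a hyperplane with some coordinate [j]; a nearby point of [F] whose only
    vanishing coordinate is [i] forces [j = i]. *)
Lemma hypersurface_local F c x i : atlas c -> chart_dom c x ->
  i \in boundary_coords c x -> codim F = 1 ->
  (\forall y \near x, boundary_coords c y = [set i]%SET -> open_face F y) ->
  \forall y \near x, closed_face F y <-> chart_coord c y ord0 i = 0.
Proof.
move=> ac Dx iZ kF FN; have cP := atlas_chart ac.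
have iS : [set i]%SET \subset boundary_coords c x by rewrite finset.sub1set.
have Fx := piece_closed_face ac Dx iS FN.
have [j jZ jN] := mwf_embedded kF ac Dx Fx.
suff ij : j = i by rewrite ij in jN.
have N := @filterI _ _ (nbhs_filter x) _ _ FN jN.
have [y [[Fy jy] Dy yi]] := piece_adherent cP Dx iS N.
have /jy yj : closed_face F y by apply/open_sub_closed_face/Fy.
apply/finset.set1P; rewrite -yi mem_boundary_coords yj eqxx andbT.
by move: jZ; rewrite mem_boundary_coords => /andP[].
Qed.

(* Embeddedness excludes that a face meets a chart in two pieces: whether i
   belongs to the index is decided by the global relation between F and the
   hypersurface {c_i = 0}. *)
Lemma face_index F c x : atlas c -> chart_dom c x -> closed_face F x ->
  exists A, index_at F c x A.
Proof.
move=> ac Dx Fx; have cP := atlas_chart ac.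
have [A [AZ kA FA]] := face_local ac Dx Fx; exists A; split => //.
(* All points of [F] have [codim F] vanishing coordinates, which is the size of [A], so an inclusion
   is enough. *)
suff H : \forall y \near x, open_face F y -> A \subset boundary_coords c y.
  near=> y; split; last by near: y.
  move=> Fy; have Dy : chart_dom c y by near: y; exact: near_chart_dom.
  apply/esym/eqP; rewrite eqEcard (face_depth ac Dy Fy) kA leqnn andbT.
  by move: Fy; near: y.
suff : \forall y \near x, forall i, i \in A -> open_face F y -> i \in boundary_coords c y.
  by apply: filterS => y H Fy; apply/fintype.subsetP => i iA; exact: H.
apply: filter_forall => i.
have [iA|iA] := boolP (i \in A); last by apply: nearW.
have iZ := fintype.subsetP AZ _ iA.
have iS : [set i]%SET \subset boundary_coords c x by rewrite finset.sub1set.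
have [H [kH HN]] := piece_face ac Dx iS; rewrite cards1 in kH.
have HL := hypersurface_local ac Dx iZ kH HN.
(* [H] is locally the whole hyperplane of the coordinate [i]. It contains the piece [A], hence by
   the frontier condition all of [F], including any other piece of [F] near [x]. *)
have sFH : subface F H.
  have N := @filterI _ _ (nbhs_filter x) _ _ FA HL.
  have [y [[Fy Hy] Dy yA]] := piece_adherent cP Dx AZ N.
  apply: (frontier (Fy yA)); apply/Hy/eqP.
  by move: iA; rewrite -yA mem_boundary_coords => /andP[].
have ir : (i < chart_rank c)%N by move: iZ; rewrite mem_boundary_coords => /andP[].
apply: filterS HL => y Hy _ Fy; rewrite mem_boundary_coords ir.
by apply/eqP/Hy; apply: sFH; exact: open_sub_closed_face.
Unshelve. all: end_near. Qed.

Lemma index_open F c x A : index_at F c x A -> open_face F x ->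
  A = boundary_coords c x.
Proof. by case=> _ _ /nbhs_singleton FA /FA. Qed.

Lemma index_closed_face F c x A : atlas c -> chart_dom c x ->
  index_at F c x A -> closed_face F x.
Proof.
move=> ac Dx [AZ _ FA]; apply: (piece_closed_face ac Dx AZ).
by apply: filterS FA => y [].
Qed.

Lemma index_adherent F c x A (N : set M) : atlas c -> chart_dom c x ->
  index_at F c x A -> nbhs x N ->
  exists y, [/\ N y, chart_dom c y, open_face F y & boundary_coords c y = A].
Proof.
move=> ac Dx [AZ _ FA] Nx; have cP := atlas_chart ac.
have [y [[Fy Ny] Dy yA]] := piece_adherent cP Dx AZ (@filterI _ _ (nbhs_filter x) _ _ FA Nx).
by exists y; split => //; apply/Fy.
Qed.

Lemma face_index_inj F G c x A : atlas c -> chart_dom c x ->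
  index_at F c x A -> index_at G c x A -> F = G.
Proof.
move=> ac Dx iF [_ kG GA].
have [y [Gy _ Fy yA]] := index_adherent ac Dx iF GA.
apply: (face_inj (y:=y)) => //; last exact/Gy.
by case: iF => _ <- _.
Qed.

Lemma index_ex c x A : atlas c -> chart_dom c x ->
  A \subset boundary_coords c x -> exists F, index_at F c x A.
Proof.
move=> ac Dx AZ; have [F [kF FA]] := piece_face ac Dx AZ; exists F.
have Fx := piece_closed_face ac Dx AZ FA.
have [B iB] := face_index ac Dx Fx.
suff -> : A = B by [].
have [_ _ FB] := iB.
have [y [[H1 H2] Dy yA]] := piece_adherent (atlas_chart ac) Dx AZ
  (@filterI _ _ (nbhs_filter x) _ _ FA FB).
by rewrite -yA; apply/H2/H1.
Qed.

(** Forward, a point of index [B] is approached by points of index [A], and boundary coordinates can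
    only be lost nearby. Backward, the piece [A] accumulates on the piece [B], and the frontier
    condition makes this global. *)
Lemma index_subface F G c x A B : atlas c -> chart_dom c x ->
  index_at F c x A -> index_at G c x B -> subface G F <-> A \subset B.
Proof.
move=> ac Dx iF iG; have cP := atlas_chart ac; have [_ _ FA] := iF; split=> [GF|AB].
  have N := @filterI _ _ (nbhs_filter x) _ _ (near_chart_dom cP Dx) (near_join FA).
  have [y [[_ Ny] Dy Gy yB]] := index_adherent ac Dx iG N.
  have /(_ _ (@filterI _ _ (nbhs_filter y) _ _ Ny (near_boundary_coords cP Dy))) :
    closed_face F y by apply/GF/open_sub_closed_face.
  by move=> [z [Fz [HA zy]]]; move/HA: Fz => <-; rewrite -yB.
have N : \forall y \near x, A \subset boundary_coords c y -> closed_face F y.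
  by apply: piece_closure => //; apply: filterS FA => y [].
have [y [Fy _ Gy yB]] := index_adherent ac Dx iG N.
by apply: (frontier Gy); apply: Fy; rewrite yB.
Qed.

Lemma facet_index F G c x B : atlas c -> chart_dom c x -> facet G F ->
  index_at G c x B ->
  exists2 i, i \in B & index_at F c x (B :\ i)%SET.
Proof.
move=> ac Dx [GF kG] iG.
have Fx : closed_face F x by apply: GF; exact: index_closed_face iG.
have [A iA] := face_index ac Dx Fx.
have /(index_subface ac Dx iA iG) AB := GF.
have [_ kA _] := iA; have [_ kB _] := iG.
have /cards1P[i BA] : #|B :\: A| == 1.
  by rewrite cardsD (finset.setIidPr AB) kA kB kG subSnn.
exists i; first by have := finset.set11 i; rewrite -BA inE => /andP[].
suff -> : (B :\ i)%SET = A by [].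
by rewrite -BA finset.setDDr finset.setDv finset.set0U; apply/finset.setIidPr.
Qed.

(** Near a point every face that occurs is the one attached to some subset of the boundary
    coordinates, so only finitely many occur; compactness turns this local bound into a global
    one. *)
Lemma finite_faces : compact [set: M] -> finite_set [set: faces M].
Proof.
move=> /compact_near_coveringP cM.
(* The filter of properties that hold for all sufficiently large sets of faces, large meaning
   containing a given finite set. *)
pose Fin : set_system (set (faces M)) :=
  [set Q | exists2 D, finite_set D & forall E, D `<=` E -> Q E].
have FinF : Filter Fin.
  split.
  - by exists set0.
  - move=> P Q [D fD DP] [E fE EQ]; exists (D `|` E); first by rewrite finite_setU.
    by move=> K DE; split; [apply: DP|apply: EQ] => a ?; apply: DE; [left|right].
  - by move=> P Q PQ [D fD DP]; exists D => // E /DP/PQ.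
have [|D fD] := cM _ Fin (fun E y => forall F, open_face F y -> E F) FinF; last first.
  move=> /(_ _ (@subset_refl _ _)) H; apply: sub_finite_set fD => F _.
  by have [y Fy] := open_face_nonempty F; exact: (H y I F Fy).
move=> x _; have [c ac Dx] := atlas_cover x; have cP := atlas_chart ac.
(* For [A] not among the boundary coordinates the chosen face is an arbitrary default. *)
have PF A : exists F, A \subset boundary_coords c x -> index_at F c x A.
  have [AZ|AZ] := boolP (A \subset boundary_coords c x).
    by have [F iF] := index_ex ac Dx AZ; exists F.
  have [F _] := index_ex ac Dx (finset.sub0set _); by exists F.
have [f fP] := choice PF.
have N : \forall y \near x, forall A, A \subset boundary_coords c x ->
    boundary_coords c y = A -> open_face (f A) y.
  apply: filter_forall => A.
  have [AZ|_] := boolP (A \subset boundary_coords c x); last exact: nearW.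
  by have [_ _] := fP A AZ; apply: filterS => y [_ Fy] _ /Fy.
exists ([set y | forall F, open_face F y -> range f F], [set E | range f `<=` E]).
  split => /=; last by exists (range f) => //; exact: finite_image.
  near=> y => F Fy.
  have Dy : chart_dom c y by near: y; exact: near_chart_dom.
  have yx : boundary_coords c y \subset boundary_coords c x.
    by near: y; exact: near_boundary_coords.
  exists (boundary_coords c y) => //.
  have Ny : forall A, A \subset boundary_coords c x -> boundary_coords c y = A ->
    open_face (f A) y by near: y.
  have Gy := Ny _ yx erefl.
  by apply: (face_inj (y:=y)) => //; rewrite -(face_depth ac Dy Fy) -(face_depth ac Dy Gy).
by move=> [y E] /= [H1 H2] F /H1 /H2.
Unshelve. all: end_near. Qed.

End FaceIndex.

(** * Orientations and incidence numbers *)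

Lemma connected_locally_constant (T : topologicalType) (C : set T) (f : T -> bool) :
  connected C -> (forall x, C x -> \forall y \near x, C y -> f y = f x) ->
  forall x y, C x -> C y -> f x = f y.
Proof.
move=> cC fC x y Cx Cy.
pose O b := interior [set z | C z -> f z = b].
have OP b z : C z -> O b z <-> f z = b.
  move=> Cz; split=> [/nbhs_singleton/(_ Cz)//|<-]; exact: fC.
suff E : C `&` O (f x) = C by have : C y by []; rewrite -E => -[_ /(OP _ _ Cy)].
apply: cC.
- by exists x; split => //; apply/OP.
- by exists (O (f x)) => //; exact: open_interior.
- exists (~` O (~~ f x)); first by apply: open_closedC; exact: open_interior.
  rewrite eqEsubset; split=> z [Cz] H; split => //=.
    by move/(OP _ _ Cz); move/(OP _ _ Cz): H => ->; case: (f x).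
  apply/(OP _ _ Cz); apply: contra_notP H => H; apply/(OP _ _ Cz).
  by case: (f z) (f x) H => -[].
Qed.

Section Orientation.
Context {R : realType} {n : nat} {M : manifold_with_faces R n}
  (o : face_orientations M).
Implicit Types (F G H : faces M) (c : chart R n M) (x y : M) (A B : {set 'I_n}).

(** Collects what the comparison of signs needs from a coordinate change. Invertibility, tangency
    and orientation are stated at all nearby points, since the orientation of [F] is read near, not
    at, a point of its facet. *)
Lemma chart_change c c' x : atlas c -> atlas c' -> chart_dom c x ->
  chart_dom c' x -> exists J : M -> 'M[R]_n,
  [/\ forall i j, J y i j @[y --> x] --> J x i j,
      forall u, cone (boundary_coords c x) u -> cone (boundary_coords c' x) (u *m J x) &
      \forall y \near x, [/\ chart_dom c y, chart_dom c' y, J y \in unitmx,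
        forall m (w : 'M[R]_(m, n)), rows_tangent (boundary_coords c y) w ->
          rows_tangent (boundary_coords c' y) (w *m J y) &
        forall F m (w : 'M[R]_(m, n)), open_face F y -> (m + codim F)%N = n ->
          row_free w -> rows_tangent (boundary_coords c y) w ->
          orF o F c' y (w *m J y) = orF o F c y w]].
Proof.
move=> ac ac' Dx Dx'; have cP := atlas_chart ac; have cP' := atlas_chart ac'.
have [f fT] := atlas_smooth ac ac' Dx Dx'.
exists (fun y => 'J f (chart_coord c y)); split.
- exact: near_jacobian_cvg fT.
- by move=> u; exact: transition_cone.
- near=> y.
  have Dy : chart_dom c y by near: y; exact: near_chart_dom.
  have Dy' : chart_dom c' y by near: y; exact: near_chart_dom.
  have fTy : is_transition c c' y f by near: y; exact: near_transition fT.
  split => //.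
  + have [g gT] := atlas_smooth ac' ac Dy' Dy.
    exact: (mulmx1_unit (transition_inverse cP cP' Dy Dy' fTy gT)).1.
  + by move=> m w; exact: transition_tangent.
  + move=> F m w Fy mk wf wZ.
    by have [_ H _] := orF_P o ac Dy Fy mk wf wZ; exact: H.
Unshelve. all: end_near. Qed.

(** [outward] asks only for some negative boundary coordinate. Tangency to [F] at nearby points
    kills all boundary coordinates except the one [i] that separates [F] from [G], so the negative
    one is [i]. *)
Lemma outward_index F G c x (v : 'rV[R]_n) : atlas c -> chart_dom c x ->
  facet G F -> open_face G x -> outward F c x v ->
  exists i, [/\ i \in boundary_coords c x,
    index_at F c x (boundary_coords c x :\ i)%SET, v ord0 i < 0 &
    rows_tangent (boundary_coords c x :\ i)%SET v].
Proof.
move=> ac Dx GF Gx [[j jZ vj] vN].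
have [B iG] := face_index ac Dx (open_sub_closed_face Gx).
move: (iG); rewrite (index_open iG Gx) => {B}iG.
have [i iZ iF] := facet_index ac Dx GF iG.
have [y [Fy _ yF yA]] := index_adherent ac Dx iF vN.
have vA := Fy yF; rewrite yA in vA.
exists i; split => //.
have [<-//|ji] := eqVneq j i.
by have := vA ord0 j; rewrite !inE ji -mem_boundary_coords jZ => /(_ isT) v0; rewrite v0 ltxx in vj.
Qed.

Lemma outward_of_index F c x i (v : 'rV[R]_n) : i \in boundary_coords c x ->
  index_at F c x (boundary_coords c x :\ i)%SET -> v ord0 i < 0 ->
  rows_tangent (boundary_coords c x :\ i)%SET v -> outward F c x v.
Proof.
move=> iZ [_ _ FA] vi vA; split; first by exists i.
by apply: filterS FA => y [H _] /H ->.
Qed.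

(** The test data over which [induced_orientation_agrees] quantifies. *)
Record outward_frame F G c x m (w : 'M[R]_(m, n)) (v : 'rV[R]_n) : Prop :=
  OutwardFrame {
    outward_frame_atlas : atlas c;
    outward_frame_dom : chart_dom c x;
    outward_frame_face : open_face G x;
    outward_frame_dim : (m + codim G)%N = n;
    outward_frame_free : row_free w;
    outward_frame_tangent : rows_tangent (boundary_coords c x) w;
    outward_frame_outward : outward F c x v }.

(** [e = false] means agreement and [e = true] reversal, so the sign is $(-1)^e$. *)
Definition sign_agrees (e : bool) F G c x m (w : 'M[R]_(m, n)) (v : 'rV[R]_n) :=
  \forall y \near x, open_face F y ->
    orF o F c y (col_mx v w) = e (+) orF o G c x w.

Lemma codim_le F : (codim F <= n)%N.
Proof.
have [x Fx] := open_face_nonempty F; have [c ac Dx] := atlas_cover x.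
by rewrite -(face_depth ac Dx Fx) -[X in (_ <= X)%N](card_ord n) max_card.
Qed.

(** The point [x] need not lie in [open_face F], so local constancy of the orientation at [x] is not
    given. Near [x], however, [F] is one piece, and two of its points are joined by a connected
    subset of [F] along which the orientation is locally constant. *)
Lemma near_orientation F c x A m (u : 'M[R]_(m, n)) : atlas c -> chart_dom c x ->
  index_at F c x A -> (m + codim F)%N = n -> row_free u -> rows_tangent A u ->
  exists b, \forall y \near x, open_face F y -> orF o F c y u = b.
Proof.
move=> ac Dx iF uF uf uA; have cP := atlas_chart ac.
have [U Ux UP] := local_piece cP Dx.
have [_ _ FA] := iF.
have [y0 [Uy0 Dy0 Fy0 y0A]] := index_adherent ac Dx iF Ux.
exists (orF o F c y0 u).
near=> y => Fy.
have Uy : U y by near: y.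
have yA : boundary_coords c y = A by apply: (near FA y _).1.
have [|C [cC Cy Cy0 CS]] := UP _ _ Uy Uy0; first by rewrite yA y0A.
apply: (connected_locally_constant (f := fun z => orF o F c z u) cC) => // z Cz.
have CF : C `<=` open_face F.
  apply: (connected_sub_face cC _ Cy Fy) => v /CS[Dv vy].
  by apply/(stratum_depth _ ac Dv); rewrite vy (face_depth ac _ Fy)//; have [] := CS y Cy.
have [Dz zy] := CS z Cz.
have zA : rows_tangent (boundary_coords c z) u by rewrite zy yA.
have [_ _] := orF_P o ac Dz (CF _ Cz) uF uf zA.
by apply: filterS => v H /CF/H.
Unshelve. all: end_near. Qed.

Lemma sign_agrees_ex F G c x m (w : 'M[R]_(m, n)) v : facet G F ->
  outward_frame F G c x w v -> exists e, sign_agrees e F G c x w v.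
Proof.
move=> GF [ac Dx Gx mG wf wZ vo].
have [i [iZ iF vi vA]] := outward_index ac Dx GF Gx vo.
have uf : row_free (col_mx v w) by apply: (row_free_outward iZ) => //; rewrite lt_eqF.
have uA : rows_tangent (boundary_coords c x :\ i)%SET (col_mx v w).
  by apply: rows_tangent_col_mx => //; apply: rows_tangentS wZ; exact: finset.subD1set.
have uF : (1 + m + codim F)%N = n.
  by have [_ kG] := GF; rewrite addnAC add1n -kG addnC.
have [b bN] := near_orientation ac Dx iF uF uf uA.
exists (b (+) orF o G c x w); rewrite /sign_agrees.
by apply: filterS bN => y H /H ->; rewrite addbK.
Qed.


(** Independence of chart, frame and outward vector. After transport to the second chart the two
    frames differ by a block triangular matrix with positive corner [l] and lower block [C]. Its
    determinant has the sign of $\det C$, so the orientations of [F] and [G] change alike. *)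
Lemma sign_agrees_change e F G c c' x m (w w' : 'M[R]_(m, n)) v v' :
  facet G F -> outward_frame F G c x w v -> outward_frame F G c' x w' v' ->
  sign_agrees e F G c x w v -> sign_agrees e F G c' x w' v'.
Proof.
move=> GF [ac Dx Gx mG wf wZ vo] [ac' Dx' _ _ wf' wZ' vo'] ew.
have [i [iZ iF vi vA]] := outward_index ac Dx GF Gx vo.
have [i' [iZ' iF' vi' vA']] := outward_index ac' Dx' GF Gx vo'.
set Z := boundary_coords c x in iZ iF wZ vA.
set Z' := boundary_coords c' x in iZ' iF' wZ' vA'.
set A := (Z :\ i)%SET in iF vA; set A' := (Z' :\ i')%SET in iF' vA'.
have [[_ kA FA] [_ kA' FA']] := (iF, iF').
have AZ : A \subset Z by exact: finset.subD1set.
have AZ' : A' \subset Z' by exact: finset.subD1set.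
have uA : rows_tangent A (col_mx v w).
  by apply: rows_tangent_col_mx => //; exact: rows_tangentS wZ.
have uf : row_free (col_mx v w) by apply: (row_free_outward iZ) => //; rewrite lt_eqF.
have uF : (1 + m + codim F)%N = n by have [_ kG] := GF; rewrite addnAC add1n -kG addnC.
have mZ' : (m + #|Z'|)%N = n by rewrite /Z' (face_depth ac' Dx' Gx).
have [J [Jc JK JN]] := chart_change ac ac' Dx Dx'.
have [_ _ Ju JZ Jo] := nbhs_singleton JN.
pose K := col_mx v w *m J x.
have Kf : row_free K by rewrite /row_free /K mxrankMfree// row_free_unit.
have KE : K = col_mx (v *m J x) (w *m J x) by rewrite /K mul_col_mx.
(* At [x] itself [transition_tangent] does not speak of [F]. A nonzero entry would persist at nearby
   points of [F], where tangency makes it vanish. *)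
have KA : rows_tangent A' K.
  move=> a j jA; apply/eqP; apply: contrapT => /negP K0.
  have N : \forall y \near x, (col_mx v w *m J y) a j != 0.
    have /= H := @cvg_mulmxr _ _ _ (nbhs_pfilter x) _ _ _ (col_mx v w) J (J x) Jc a j.
    exact: (H [set z | z != 0] (open_nbhs_nbhs (conj (@open_neq R 0) K0))).
  have N2 := @filterI _ _ (nbhs_filter x) _ _ N (@filterI _ _ (nbhs_filter x) _ _ JN (@filterI _ _ (nbhs_filter x) _ _ FA FA')).
  have [y [[Ny [[_ _ _ H _] [F1 F2]]] _ Fy _]] := index_adherent ac Dx iF N2.
  move/eqP: Ny; apply; apply: H; last by rewrite (F2.1 Fy).
  by rewrite (F1.1 Fy).
have wJf : row_free (w *m J x) by rewrite /row_free mxrankMfree// row_free_unit.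
have wJZ := JZ _ _ wZ.
pose C := w' *m pinvmx (w *m J x).
have CE : w' = C *m (w *m J x) by rewrite mulmxKpV// (tangent_submx wJf wJZ).
have Cu : C \in unitmx.
  rewrite -row_free_unit /row_free eqn_leq rank_leq_row /=.
  by move: wf'; rewrite {1}CE /row_free => /eqP {1}<-; exact: mxrankM_maxl.
have vJA j : j \in A' -> (v *m J x) ord0 j = 0.
  by move=> jA; have := KA (lshift m ord0) j jA; rewrite KE mxE; case: splitP => // a _; rewrite (ord1 a).
(* The cone gives the weak inequality. Equality would make the transported [v] tangent to [G], hence
   a combination of the transported [w], against independence. *)
have vJi : (v *m J x) ord0 i' < 0.
  have : cone Z (- v).
    move=> j jZ; rewrite mxE oppr_ge0.
    by have [->|ji] := eqVneq j i; [exact: ltW|rewrite vA ?lexx// finset.in_setD1 ji].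
  move=> /JK /(_ i' iZ'); rewrite mulNmx mxE oppr_ge0 le_eqVlt => /orP[/eqP v0|//].
  have vJZ : rows_tangent Z' (v *m J x).
    move=> a j jZ; rewrite (ord1 a); have [->//|ji] := eqVneq j i'.
    by rewrite vJA// finset.in_setD1 ji.
  have /submxP[D DE] := tangent_submx wJf wJZ mZ' vJZ.
  have : row_mx 1%:M (- D) *m K = 0 by rewrite KE mul_row_col mul1mx mulNmx -DE subrr.
  move/eqP; rewrite mulmx_free_eq0// => /eqP/matrixP/(_ ord0 (lshift m ord0)).
  by rewrite row_mxEl !mxE eqxx => /eqP; rewrite oner_eq0.
(* The multiple for which [v'] and the transported [v] have the same coordinate [i'], so that their
   difference is tangent to [G]. *)
pose l := v' ord0 i' / (v *m J x) ord0 i'.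
have l0 : 0 < l by rewrite nmulr_rgt0// invr_lt0.
have vZ : rows_tangent Z' (v' - l *: (v *m J x)).
  move=> a j jZ; rewrite (ord1 a).
  have -> : (v' - l *: (v *m J x)) ord0 j = v' ord0 j - l * (v *m J x) ord0 j by rewrite !mxE.
  have [->|ji] := eqVneq j i'; first by rewrite /l divfK ?lt_eqF// subrr.
  have jA : j \in A' by rewrite finset.in_setD1 ji.
  by rewrite vJA// vA'// mulr0 subr0.
have /submxP[b bE] := tangent_submx wJf wJZ mZ' vZ.
pose B : 'M[R]_(1 + m) := block_mx l%:M b 0 C.
have BE : col_mx v' w' = B *m K.
  by rewrite KE mul_block_col mul0mx add0r -CE mul_scalar_mx -bE addrC subrK.
have dB : \det B = l * \det C by rewrite det_ublock det_scalar1.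
have Bu : B \in unitmx by rewrite unitmxE dB unitrM -unitmxE Cu unitfE gt_eqF.
have sB : (\det B < 0) = (\det C < 0) by rewrite dB pmulr_rlt0.
have [Co _ _] := orF_P o ac' Dx' Gx mG wJf wJZ.
have := Co C Cu; rewrite -CE (Jo _ _ _ Gx mG wf wZ) => oG.
(* The frame transported by [J y] varies with [y], while [K] is fixed; [D y] expresses the former in
   the latter. It is the identity at [x], so its determinant is positive nearby and both frames have
   the same sign. *)
pose D y := col_mx v w *m J y *m pinvmx K.
have Dx1 : D x = 1%:M by rewrite /D mulmxVp.
have Dc : \det (D y) @[y --> x] --> (1:R).
  rewrite -(det1 R (1 + m)) -Dx1.
  apply: (@cvg_det _ _ _ (nbhs_pfilter x)) => a j.
  apply: (@cvg_mulmx _ _ _ (nbhs_pfilter x)) => {}a {}j.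
  exact: (@cvg_mulmxr _ _ _ (nbhs_pfilter x) _ _ _ _ J (J x) Jc).
have Dpos : \forall y \near x, 0 < \det (D y).
  exact: (Dc [set z | 0 < z] (open_nbhs_nbhs (conj (@open_gt R 0) (@ltr01 R)))).
near=> y => Fy.
have [Dy Dy' _ JyZ Jyo] : [/\ chart_dom c y, chart_dom c' y, J y \in unitmx,
    forall m (w : 'M[R]_(m, n)), rows_tangent (boundary_coords c y) w ->
      rows_tangent (boundary_coords c' y) (w *m J y) &
    forall F m (w : 'M[R]_(m, n)), open_face F y -> (m + codim F)%N = n ->
      row_free w -> rows_tangent (boundary_coords c y) w ->
      orF o F c' y (w *m J y) = orF o F c y w] by near: y.
have yA : boundary_coords c y = A by apply: (near FA y _).1.
have yA' : boundary_coords c' y = A' by apply: (near FA' y _).1.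
have uJy : rows_tangent A' (col_mx v w *m J y) by rewrite -yA'; apply: JyZ; rewrite yA.
have mA' : (1 + m + #|A'|)%N = n by rewrite kA'.
have DE : col_mx v w *m J y = D y *m K.
  by rewrite mulmxKpV// (tangent_submx Kf KA).
have Dy0 : 0 < \det (D y) by near: y.
have Du : D y \in unitmx by rewrite unitmxE unitfE gt_eqF.
have KyA : rows_tangent (boundary_coords c' y) K by rewrite yA'.
have [Ko _ _] := orF_P o ac' Dy' Fy uF Kf KyA.
have oD : orF o F c' y K = orF o F c y (col_mx v w).
  have := Ko _ Du; rewrite -DE (ltNge _ 0) (ltW Dy0) /= addbF => <-.
  by apply: Jyo => //; rewrite yA.
rewrite BE (Ko _ Bu) sB oD oG addbA; congr (_ (+) _).
by move: Fy; near: y.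
Unshelve. all: end_near. Qed.


Lemma sign_agrees_uniq e e' F G c x m (w : 'M[R]_(m, n)) v : facet G F ->
  open_face G x ->
  sign_agrees e F G c x w v -> sign_agrees e' F G c x w v -> e = e'.
Proof.
move=> [GF _] Gx h h'.
have /(_ _ (@filterI _ _ (nbhs_filter x) _ _ h h')) : closed_face F x.
  by apply/GF/open_sub_closed_face.
move=> [y [Fy [h1 h2]]].
by apply: (@addIb (orF o G c x w)); rewrite -(h1 Fy) -(h2 Fy).
Qed.

(** Along [G] the boundary coordinates are constant near [x], so the same frame and outward vector
    can be used at nearby points. *)
Lemma near_sign_agrees e F G c x m (w : 'M[R]_(m, n)) v : facet G F ->
  outward_frame F G c x w v -> sign_agrees e F G c x w v ->
  \forall y \near x, open_face G y ->
    outward_frame F G c y w v /\ sign_agrees e F G c y w v.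
Proof.
move=> GF [ac Dx Gx mG wf wZ vo] h; have cP := atlas_chart ac.
have [_ _ oG] := orF_P o ac Dx Gx mG wf wZ.
have [[i iZ vi] vN] := vo.
have hh := near_join h; have vNN := near_join vN.
near=> y => Gy.
have Dy : chart_dom c y by near: y; exact: near_chart_dom.
have yx : boundary_coords c y = boundary_coords c x.
  apply/eqP; rewrite eqEcard (face_depth ac Dy Gy) (face_depth ac Dx Gx) leqnn andbT.
  by near: y; exact: near_boundary_coords.
have e1 : orF o G c y w = orF o G c x w by move: Gy; near: y.
split.
  split => //; first by rewrite yx.
  by split; [exists i; rewrite ?yx|near: y].
by rewrite /sign_agrees e1; near: y.
Unshelve. all: end_near. Qed.

Local Notation outv i := (- delta_mx ord0 i : 'rV[R]_n).

Lemma outward_delta (Z : {set 'I_n}) i : rows_tangent (Z :\ i)%SET (outv i).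
Proof.
move=> a j; rewrite finset.in_setD1 => /andP[ji _]; rewrite !mxE eqE /= (negbTE ji) andbF oppr0 //.
Qed.

Lemma delta_lt0 i : (outv i) ord0 i < 0.
Proof. by rewrite !mxE !eqxx oppr_lt0 ltr01. Qed.

Lemma outward_frame_ex F G c x : facet G F -> atlas c -> chart_dom c x ->
  open_face G x -> exists m (w : 'M[R]_(m, n)) v, outward_frame F G c x w v.
Proof.
move=> GF ac Dx Gx.
have [B iG] := face_index ac Dx (open_sub_closed_face Gx).
move: (iG); rewrite (index_open iG Gx) => {B}iG.
have [i iZ iF] := facet_index ac Dx GF iG.
exists #|~: boundary_coords c x|, (coord_frame _), (outv i); split => //.
- by rewrite -(face_depth ac Dx Gx) addnC cardsC card_ord.
- exact: coord_frame_free.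
- exact: coord_frame_tangent.
- exact: (outward_of_index iZ iF (delta_lt0 i) (@outward_delta _ i)).
Qed.

Definition signs_at F G x (e : bool) := forall c m (w : 'M[R]_(m, n)) v,
  outward_frame F G c x w v -> sign_agrees e F G c x w v.

Lemma signs_at_frame e F G c x m (w : 'M[R]_(m, n)) v : facet G F ->
  outward_frame F G c x w v -> sign_agrees e F G c x w v -> signs_at F G x e.
Proof.
move=> GF ow ew c' m' w' v' ow'.
have mm : m = m'.
  by apply/eqP; rewrite -(eqn_add2r (codim G)) (outward_frame_dim ow) (outward_frame_dim ow').
case: _ / mm in w' ow' *; exact: sign_agrees_change ow ow' ew.
Qed.

Lemma signs_at_ex F G x : facet G F -> open_face G x ->
  exists e, signs_at F G x e.
Proof.
move=> GF Gx; have [c ac Dx] := atlas_cover x.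
have [m [w [v ow]]] := outward_frame_ex GF ac Dx Gx.
have [e ew] := sign_agrees_ex GF ow; exists e; exact: signs_at_frame ow ew.
Qed.

Lemma signs_at_uniq F G x e e' : facet G F -> open_face G x ->
  signs_at F G x e -> signs_at F G x e' -> e = e'.
Proof.
move=> GF Gx h h'; have [c ac Dx] := atlas_cover x.
have [m [w [v ow]]] := outward_frame_ex GF ac Dx Gx.
exact: (sign_agrees_uniq GF Gx (h _ _ _ _ ow) (h' _ _ _ _ ow)).
Qed.

Lemma near_signs_at F G x e : facet G F -> open_face G x -> signs_at F G x e ->
  \forall y \near x, open_face G y -> signs_at F G y e.
Proof.
move=> GF Gx h; have [c ac Dx] := atlas_cover x.
have [m [w [v ow]]] := outward_frame_ex GF ac Dx Gx.
have := near_sign_agrees GF ow (h _ _ _ _ ow).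
by apply: filterS => y H /H[ow' ew]; exact: signs_at_frame ow' ew.
Qed.

(** The sign at a point is unique and locally constant along the connected [open_face G], hence
    constant. *)
Lemma incidence_sign F G : facet G F -> exists e : bool,
  incidence o F G = (-1) ^+ e /\ forall x, open_face G x -> signs_at F G x e.
Proof.
move=> GF.
have /choice[s sP] : forall x, exists e, open_face G x -> signs_at F G x e.
  move=> x; have [Gx|nGx] := pselect (open_face G x); last by exists false.
  by have [e ?] := signs_at_ex GF Gx; exists e.
have [x0 Gx0] := open_face_nonempty G.
have sE x : open_face G x -> s x = s x0.
  move=> Gx; apply: (connected_locally_constant (@open_face_connected _ _ _ G)) => // y Gy.
  have := near_signs_at GF Gy (sP y Gy); apply: filterS => z H Gz.
  exact: (signs_at_uniq GF Gz (sP _ Gz) (H Gz)).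
exists (s x0); split; last by move=> x Gx; rewrite -(sE _ Gx); exact: sP.
(* [incidence] is -1 as soon as agreement fails for one choice; constancy of [s] shows that the sign
   is then reversed for every choice. *)
rewrite /incidence; case: asboolP => H.
  suff -> : s x0 = false by [].
  apply: (signs_at_uniq GF Gx0 (sP _ Gx0)) => c m w v [ac Dx Gx mG wf wZ vo].
  exact: H.
suff -> : s x0 by [].
apply/negPn/negP => s0; apply: H => c x m w v ac Dx Gx mG wf wZ vo.
have ow : outward_frame F G c x w v by split.
have := sP _ Gx _ _ _ _ ow; rewrite (sE _ Gx) (negbTE s0); exact.
Qed.

(** * Cancellation between the two intermediate faces *)

Lemma col_mx_swap m (a b : 'rV[R]_n) (w : 'M[R]_(m, n)) :
  exists2 P : 'M[R]_(1 + (1 + m)), \det P = -1 &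
    col_mx a (col_mx b w) = P *m col_mx b (col_mx a w).
Proof.
pose k0 : 'I_(1 + (1 + m)) := lshift _ ord0.
pose k1 : 'I_(1 + (1 + m)) := rshift 1 (lshift m ord0).
exists (tperm_mx k0 k1); first by rewrite det_perm perm.odd_tperm.
rewrite -xrowE; apply/matrixP => k j; rewrite [RHS]mxE.
have [k' ->|k' ->] := split_ordP k; rewrite ?(ord1 k').
  by rewrite perm.tpermL col_mxEu col_mxEd col_mxEu.
have [k'' ->|k'' ->] := split_ordP k'; rewrite ?(ord1 k'').
  by rewrite perm.tpermR col_mxEu col_mxEd col_mxEu.
by rewrite perm.tpermD ?col_mxEd.
Qed.

(** The product of the two incidence numbers compares [F] with [H] directly, through the frame with
    both outward vectors in front: from [H] to [G] at [x], then from [G] to [F] at a nearby point of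
    [G]. *)
Lemma incidence_pair F G H c x i j m (w : 'M[R]_(m, n)) :
  facet G F -> facet H G -> atlas c -> chart_dom c x -> open_face H x ->
  i \in boundary_coords c x -> j \in boundary_coords c x -> j != i ->
  index_at G c x (boundary_coords c x :\ i)%SET ->
  index_at F c x (boundary_coords c x :\ i :\ j)%SET ->
  (m + codim H)%N = n -> row_free w -> rows_tangent (boundary_coords c x) w ->
  exists e : bool, incidence o F G * incidence o G H = (-1) ^+ e /\
    \forall y \near x, open_face F y ->
      orF o F c y (col_mx (outv j) (col_mx (outv i) w)) =
      e (+) orF o H c x w.
Proof.
move=> GF HG ac Dx Hx iZ jZ ji iG iF mH wf wZ.
set Z := boundary_coords c x in iZ jZ iG iF wZ *.
have [e1 [E1 S1]] := incidence_sign HG; have [e2 [E2 S2]] := incidence_sign GF.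
exists (e1 (+) e2); split; first by rewrite E1 E2 -signr_addb addbC.
have [_ kG] := GF; have [_ kH] := HG.
have wvf : row_free (col_mx (outv i) w).
  by apply: (row_free_outward iZ) => //; rewrite lt_eqF// delta_lt0.
have wvA : rows_tangent (Z :\ i)%SET (col_mx (outv i) w).
  apply: rows_tangent_col_mx; first exact: outward_delta.
  by apply: rows_tangentS wZ; exact: finset.subD1set.
have wvG : (1 + m + codim G)%N = n by rewrite addnAC add1n -kH addnC.
have jZi : j \in (Z :\ i)%SET by rewrite finset.in_setD1 ji.
have uf : row_free (col_mx (outv j) (col_mx (outv i) w)).
  by apply: (row_free_outward jZi) => //; rewrite lt_eqF// delta_lt0.
have uA : rows_tangent (Z :\ i :\ j)%SET (col_mx (outv j) (col_mx (outv i) w)).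
  apply: rows_tangent_col_mx; first exact: outward_delta.
  by apply: rows_tangentS wvA; exact: finset.subD1set.
have uF : (1 + (1 + m) + codim F)%N = n by rewrite addnAC add1n -kG addnC.
(* The orientation of [F] on the double frame has one value near [x], so it may be evaluated at a
   point of [F] close to [y] instead of close to [x]. *)
have [b bN] := near_orientation ac Dx iF uF uf uA.
suff -> : e1 (+) e2 (+) orF o H c x w = b by [].
have owH : outward_frame G H c x w (outv i).
  by split => //; exact: (outward_of_index iZ iG (delta_lt0 i) (@outward_delta _ i)).
have N1 := S1 _ Hx _ _ _ _ owH; have [_ _ FA] := iF.
have N2 := @filterI _ _ (nbhs_filter x) _ _ N1
  (@filterI _ _ (nbhs_filter x) _ _ (near_join FA) (near_join bN)).
have [y [[Gy1 [FAy bNy]] Dy Gy yA]] := index_adherent ac Dx iG N2.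
have owG : outward_frame F G c y (col_mx (outv i) w) (outv j).
  split => //; first by rewrite yA.
  split; first by exists j; [rewrite yA|exact: delta_lt0].
  by apply: filterS FAy => z [zA _] /zA ->; exact: outward_delta.
have N3 := S2 _ Gy _ _ _ _ owG.
have Fy : closed_face F y by have [+ _] := GF; apply; exact: open_sub_closed_face.
have [z [Fz [H1 H2]]] := Fy _ (@filterI _ _ (nbhs_filter y) _ _ N3 bNy).
by rewrite -(H2 Fz) (H1 Fz) (Gy1 Gy) addbA [e2 (+) e1]addbC.
Qed.

Lemma face_index_uniq F c x A B : atlas c -> chart_dom c x -> index_at F c x A ->
  index_at F c x B -> A = B.
Proof.
move=> ac Dx iA [_ _ FB].
have [y [Fy _ Fy' <-]] := index_adherent ac Dx iA FB.
exact/Fy.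
Qed.

Lemma diamond F G H : facet G F -> facet H G -> exists G', [/\ G <> G',
  [set K | facet K F /\ facet H K] = [set G; G'] &
  incidence o F G * incidence o G H + incidence o F G' * incidence o G' H = 0].
Proof.
move=> GF HG; have [x Hx] := open_face_nonempty H.
have [c ac Dx] := atlas_cover x.
have [B iH] := face_index ac Dx (open_sub_closed_face Hx).
move: (iH); rewrite (index_open iH Hx) => {B}iH.
set Z := boundary_coords c x in iH *.
have [i iZ iG] := facet_index ac Dx HG iH.
have [j jZi iF] := facet_index ac Dx GF iG.
have [ji jZ] : j != i /\ j \in Z by move: jZi; rewrite finset.in_setD1 => /andP[].
have ij : i != j by rewrite eq_sym.
have Zij : (Z :\ i :\ j)%SET = (Z :\ j :\ i)%SET by rewrite !finset.setDDl finset.setUC.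
have [G' iG'] := index_ex ac Dx (finset.subD1set Z j).
have [_ kZ _] := iH; have [_ kG' _] := iG'; have [_ kF _] := iF.
have iF' := iF; rewrite Zij in iF'.
have G'F : facet G' F.
  split; first by apply/(index_subface ac Dx iF' iG'); exact: finset.subD1set.
  by rewrite -kG' -kF Zij [LHS](cardsD1 i) finset.in_setD1 ij iZ.
have HG' : facet H G'.
  split; first by apply/(index_subface ac Dx iG' iH); exact: finset.subD1set.
  by rewrite -kG' -kZ (cardsD1 j) jZ.
exists G'; split.
- move=> e; move: iG'; rewrite -e => /(face_index_uniq ac Dx iG)/finset.setP/(_ i).
  by rewrite !finset.in_setD1 eqxx ij iZ.
- rewrite eqEsubset; split=> [K [KF HK]|K]; last by case=> ->.
  (* The index of [K] omits one element [k] of [Z]. As it contains the index of [F], which omits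
     only [i] and [j], this [k] is one of them. *)
  have [k kZ' iK] := facet_index ac Dx HK iH.
  have [l lZ iF''] := facet_index ac Dx KF iK.
  have := face_index_uniq ac Dx iF iF'' => /finset.setP/(_ k).
  rewrite !finset.in_setD1 eqxx kZ' andbF !andbT => /negbT.
  rewrite negb_and !negbK => /orP[/eqP kj|/eqP ki]; [right|left].
    by rewrite kj in iK; exact: (face_index_inj ac Dx iK iG').
  by rewrite ki in iK; exact: (face_index_inj ac Dx iK iG).
- have mH : (#|~: Z| + codim H)%N = n by rewrite -kZ addnC cardsC card_ord.
  have wf := @coord_frame_free R n Z; have wZ := @coord_frame_tangent R n Z.
  have [e [-> N]] := incidence_pair GF HG ac Dx Hx iZ jZ ji iG iF mH wf wZ.
  have [e' [-> N']] := incidence_pair G'F HG' ac Dx Hx jZ iZ ij iG' iF' mH wf wZ.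
  have [_ _ FA] := iF.
  have N2 := @filterI _ _ (nbhs_filter x) _ _ N (@filterI _ _ (nbhs_filter x) _ _ N' FA).
  have [y [[Ny [Ny' _]] Dy Fy yA]] := index_adherent ac Dx iF N2.
  move: (Ny Fy) (Ny' Fy).
  (* The two double frames differ by a transposition of rows, so the orientation of [F] takes
     opposite values on them and [e] is the negation of [e']. *)
  have [P dP ->] := col_mx_swap (outv j) (outv i) (coord_frame Z).
  set u := col_mx (outv i) _.
  have uf : row_free u.
    apply: (row_free_outward (Z := (Z :\ j)%SET) (i := i)); rewrite ?finset.in_setD1 ?ij ?lt_eqF ?delta_lt0//.
      by apply: (row_free_outward jZ) => //; rewrite lt_eqF// delta_lt0.
    apply: rows_tangent_col_mx; first exact: outward_delta.
    by apply: rows_tangentS wZ; exact: finset.subD1set.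
  have uA : rows_tangent (boundary_coords c y) u.
    rewrite yA; apply: rows_tangent_col_mx; first by rewrite Zij; exact: outward_delta.
    apply: rows_tangent_col_mx; last by apply: rows_tangentS wZ; rewrite finset.setDDl finset.subsetDl.
    by apply: (rows_tangentS _ (@outward_delta Z j)); rewrite Zij finset.subD1set.
  have uF : (1 + (1 + #|~: Z|) + codim F)%N = n.
    by have [[_ kG] [_ kH]] := (GF, HG); rewrite -[RHS]mH kH kG !add1n !addSn !addnS.
  have [Po _ _] := orF_P o ac Dy Fy uF uf uA.
  have Pu : P \in unitmx by rewrite unitmxE dP unitrN1.
  rewrite (Po _ Pu) dP oppr_lt0 ltr01 => + uE; rewrite uE addbT -addNb => /addIb <-.
  by case: (e') => /=; rewrite ?expr0 ?expr1 ?addNr ?subrr.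
Qed.

End Orientation.

(** * The face complex and transgression *)

Section Linear.
Context {R : realType} {V W : lmodType R} {t : V -> W} (tL : linear t).

Lemma lin0 : t 0 = 0.
Proof. by have := tL (-1) 0 0; rewrite scaler0 addr0 scaleN1r addNr. Qed.

Lemma linD a b : t (a + b) = t a + t b.
Proof. by have := tL 1 a b; rewrite !scale1r. Qed.

Lemma linZ (r : R) a : t (r *: a) = r *: t a.
Proof. by have := tL r a 0; rewrite lin0 !addr0. Qed.

Lemma linB a b : t (a - b) = t a - t b.
Proof. by rewrite -scaleN1r linD linZ scaleN1r. Qed.

Lemma lin_sum (I : Type) (s : seq I) (P : pred I) (f : I -> V) :
  t (\sum_(i <- s | P i) f i) = \sum_(i <- s | P i) t (f i).
Proof. by apply: (big_morph t); [exact: linD|exact: lin0]. Qed.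

End Linear.

Lemma fsum_closed (V : nmodType) (I : choiceType) (P : V -> Prop) (D : set I)
    (f : I -> V) : P 0 -> (forall a b, P a -> P b -> P (a + b)) ->
  (forall i, P (f i)) -> P (\sum_(i \in D) f i).
Proof. by move=> P0 PD Pf; apply: big_ind. Qed.

(** Turns facet sums into filtered sums over one fixed sequence, on which sums can be exchanged. *)
Lemma fsum_asbool (V : nmodType) (I : choiceType) (P : I -> Prop) (f : I -> V) :
  finite_set [set: I] ->
  \sum_(i \in [set i | P i]) f i = \sum_(i <- fset_set [set: I] | `[< P i >]) f i.
Proof.
move=> fI; rewrite fsbig_mkcond fsbig_finite// [RHS]big_mkcond.
by apply: eq_bigr => i _; rewrite /patch; case: asboolP => Pi; [rewrite mem_set|rewrite memNset].
Qed.

(** * Forms of given degree and powers of a contraction *)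

Section Forms.
Context {R : realType}.
Implicit Types X Y : calculus R.

Lemma homog_pforms X p j (a : X) : homog p j a -> pforms p a.
Proof.
move=> ha; pose c i : X := if i == j then a else 0; exists c; split.
- by move=> i; rewrite /c; case: eqP => [->//|_]; have [] := @homog_subspace _ X p i.
- apply: (@sub_finite_set _ _ [set j]) => // i; rewrite /c /=.
  by have [->//|_] := eqVneq i j; rewrite eqxx.
- rewrite -(fsbig_widen [set j] setT)//= ?fsbig_set1 /c ?eqxx//.
  by move=> i [_ /= ij]; case: eqP.
Qed.

Lemma pforms0 X p : pforms p (0 : X).
Proof. by apply: (@homog_pforms _ _ 0); have [] := @homog_subspace _ X p 0. Qed.

Lemma pforms_lin X p (r : R) (a b : X) : pforms p a -> pforms p b ->
  pforms p (r *: a + b).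
Proof.
move=> [c [hc fc ->]] [d [hd fd ->]].
exists (fun j => r *: c j + d j); split.
- by move=> j; have [_] := @homog_subspace _ X p j; apply.
- apply: (@sub_finite_set _ _ ([set j | c j != 0] `|` [set j | d j != 0])).
    move=> j /=; have [->|] := eqVneq (c j) 0; last by left.
    by rewrite scaler0 add0r; right.
  by rewrite finite_setU.
pose D := [set j | c j != 0] `|` [set j | d j != 0].
have fD : finite_set D by rewrite finite_setU.
have wD f : (forall j, ~ D j -> f j = 0 :> X) ->
    \sum_(j \in [set: int]) f j = \sum_(j <- fset_set D) f j.
  by move=> f0; rewrite -fsbig_finite// [RHS](fsbig_widen D setT)// => j [_] /f0.
have cD j : ~ D j -> c j = 0 by move=> /not_orP[/negP/negPn/eqP].
have dD j : ~ D j -> d j = 0 by move=> /not_orP[_ /negP/negPn/eqP].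
rewrite !wD//; first by rewrite scaler_sumr -big_split.
by move=> j Dj; rewrite cD// dD// scaler0 addr0.
Qed.

Lemma pformsD X p (a b : X) : pforms p a -> pforms p b -> pforms p (a + b).
Proof. by move=> ha hb; rewrite -[a]scale1r; exact: pforms_lin. Qed.

Lemma pformsZ X p (r : R) (a : X) : pforms p a -> pforms p (r *: a).
Proof. by move=> ha; rewrite -[_ *: _]addr0; apply: pforms_lin ha (pforms0 _ _). Qed.

Lemma pforms_map X Y p q (t : X -> Y) (a : X) : linear t ->
  (forall j b, homog p j b -> pforms q (t b)) -> pforms p a -> pforms q (t a).
Proof.
move=> tL ht [c [hc fc ->]].
rewrite -(fsbig_widen [set j | c j != 0] setT)//; last first.
  by move=> j [_ /negP/negPn/eqP].
rewrite fsbig_finite// lin_sum//; apply: big_ind => [||j _]; first exact: pforms0.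
  by move=> ? ?; exact: pformsD.
exact: ht.
Qed.

Lemma pforms_bidegree X Y u v p (t : X -> Y) (a : X) : linear t ->
  has_bidegree (@homog R X) (@homog R Y) u v t -> pforms p a -> pforms (p + u) (t a).
Proof.
by move=> tL ht; apply: pforms_map => // j b /ht; exact: homog_pforms.
Qed.

(** Every form is a finite sum of terms of pure source degree: split by bidegree first, then along
    the source factor. The source degrees that occur are nonnegative. *)
Lemma product_ind (X : product_calculus R) (P : X -> Prop) : P 0 ->
  (forall a b, P a -> P b -> P (a + b)) ->
  (forall b a, 0 <= b -> src_forms b a -> P a) -> forall a, P a.
Proof.
move=> P0 PD Ps a.
have [c [[hc _ ->] _]] := homog_direct a; apply: fsum_closed => // -[p j].
have [d [[hd bd _ ->] _]] := src_direct (hc (p, j)); apply: fsum_closed => // b.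
have [->//|/bd/andP[b0 _]] := eqVneq (d b) 0.
by apply: Ps b0 _; have [] := hd b.
Qed.

Lemma exd_linear X : linear (@exd R X).
Proof. by have [] := exd_derivation X. Qed.

Lemma exd_pforms X p (a : X) : pforms p a -> pforms (p + 1) (exd a).
Proof. by apply: pforms_bidegree; [exact: exd_linear|exact: exd_bidegree]. Qed.

Lemma cohomological_linear X (i : X -> X) : cohomological i -> linear i.
Proof. by case=> [[[]]]. Qed.

(** The contraction with a field of degree one is even, so its Lie derivative [L] is a plain
    commutator, and vanishing of the contraction with the self-bracket says that [L] commutes with
    [i]. Each of the [k.+1] exchanges then contributes the same term. *)
Lemma cohomological_iter X (i : X -> X) (k : nat) (a : X) : cohomological i ->
  iter k.+1 i (exd a) =
  exd (iter k.+1 i a) + k.+1%:R *: iter k i (i (exd a) - exd (i a)).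
Proof.
move=> ic; have iL := cohomological_linear ic; have [_ iC] := ic.
pose L a := i (exd a) - exd (i a).
have LC b : L (i b) = i (L b).
  have := iC b; rewrite /contract_bracket /lie subrr mulr0 /ksign expr0 !scale1r.
  by move/eqP; rewrite subr_eq0 => /eqP.
have iterE b : i (exd b) = exd (i b) + L b by rewrite /L addrC subrK.
elim: k => [|k IH]; first by rewrite /= scale1r addrC subrK.
have LCk b : L (iter k.+1 i b) = iter k.+1 i (L b).
  by elim: (k.+1) => //= j IHj; rewrite LC IHj.
rewrite iterS IH (linD iL) (linZ iL) iterE LCk -iterS.
by rewrite -[in LHS]addrA -[X in X + _ *: _]scale1r -scalerDl -(natrD _ 1 k.+1) add1n.
Qed.

End Forms.

(** * The square of the face differential *)

Section FaceComplexes.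
Context {R : realType} {n : nat} {M : manifold_with_faces R n}
  {o : face_orientations M}.
Implicit Types F G H : faces M.

(** [dim] is a truncated subtraction; the bound on [codim G] excludes truncation. *)
Lemma facet_dim F G : facet G F -> Defs.dim F = (Defs.dim G).+1.
Proof. by case=> _ kG; rewrite /Defs.dim kG subnSK// -kG codim_le. Qed.

(** Either there is no intermediate face or, by [diamond], there are exactly two, with opposite
    terms. *)
Lemma incidence_square F H : finite_set [set: faces M] ->
  \sum_(G <- fset_set [set: faces M] | `[< facet G F >] && `[< facet H G >])
    incidence o F G * incidence o G H = 0.
Proof.
move=> fM; under eq_bigl do rewrite -asbool_and.
rewrite -fsum_asbool//.
have [[G [GF HG]]|nG] := pselect (exists G, facet G F /\ facet H G); last first.
  by rewrite [X in \sum_(_ \in X) _](_ : _ = set0) ?fsbig_set0// -subset0 => G ?; case: nG; exists G.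
have [G' [GG -> s0]] := diamond o GF HG.
by rewrite fsbigU0 ?fsbig_set1// => K /= [-> /GG].
Qed.

Context {Y : target R n} (S : mapping_spaces o Y) (fM : finite_set [set: faces M]).

Lemma bigDE (eta : face_family S) F k : bigD S eta F k =
  (-1) ^+ Defs.dim F *: exd (eta F k) +
  (if k is k'.+1 then \sum_(G <- fset_set [set: faces M] | `[< facet G F >])
     incidence o F G *: rho S F (eta G k') else 0).
Proof. by case: k => [//|k]; rewrite /bigD fsum_asbool. Qed.

Lemma rho_linear F G : facet G F -> linear (@rho _ _ _ _ _ S F G).
Proof. by case=> /(rho_pullback S)[]. Qed.

Lemma bigD_cochains p (eta : face_family S) : cochains S p eta ->
  cochains S (p + 1) (bigD S eta).
Proof.
move=> he F k; rewrite bigDE; apply: pformsD.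
  by rewrite addrAC; apply/pformsZ/exd_pforms/he.
case: k => [|k]; first exact: pforms0.
have -> : p + 1 - k.+1%:Z = p - k%:Z by rewrite -addn1 PoszD opprD addrACA subrr addr0.
rewrite big_seq_cond; apply: big_ind => [||G /andP[_ /asboolP GF]]; first exact: pforms0.
  by move=> ? ?; exact: pformsD.
have [rL _ _ rB _] := rho_pullback S GF.1.
by apply: pformsZ; rewrite -[_ - _]addr0; apply: pforms_bidegree rL rB _; exact: he.
Qed.

Lemma bigD_linear (r : R) (eta xi : face_family S) :
  bigD S (fun F k => r *: eta F k + xi F k) =
  (fun F k => r *: bigD S eta F k + bigD S xi F k).
Proof.
apply: functional_extensionality_dep => F; apply: functional_extensionality_dep => k.
rewrite !bigDE exd_linear !scalerDr addrACA scalerA mulrC -scalerA; congr (_ + _).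
case: k => [|k]; first by rewrite scaler0 addr0.
rewrite scaler_sumr -big_split; apply: eq_bigr => G /asboolP GF.
by rewrite rho_linear// scalerDr !scalerA mulrC.
Qed.

Lemma bigD_square (eta : face_family S) : bigD S (bigD S eta) = fun F k => 0.
Proof.
apply: functional_extensionality_dep => F; apply: functional_extensionality_dep => k.
have eL := @exd_linear R; rewrite bigDE (bigDE eta F).
rewrite (linD (eL _)) (linZ (eL _)) exdK scaler0 add0r.
case: k => [|k]; first by rewrite (lin0 (eL _)) scaler0 addr0.
rewrite (lin_sum (eL _)) scaler_sumr.
under [X in _ + X]eq_bigr => G /asboolP GF.
  have rP := rho_pullback S GF.1; have rL := pullback_linear rP.
  rewrite bigDE (linD rL) (linZ rL) (pullback_exd rP) scalerDr scalerA mulrC -scalerA.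
  over.
rewrite [X in _ + X]big_split /= addrA.
(* The mixed terms cancel because [F] and its facet have dimensions of opposite parity. *)
rewrite -big_split /= big1 ?add0r; last first.
  move=> G /asboolP GF.
  by rewrite (linZ (eL _)) (facet_dim GF) exprS mulN1r scaleNr addNr.
(* In degree [k = 1] the double restriction involves the component of index -1, which is zero. *)
case: k => [|k].
  by rewrite big1// => G /asboolP GF; rewrite (lin0 (rho_linear GF)) scaler0.
under eq_bigr => G /asboolP GF.
  rewrite (lin_sum (rho_linear GF)) scaler_sumr.
  under eq_bigr => H /asboolP HG.
    rewrite (linZ (rho_linear GF)) scalerA rho_comp; [|exact: GF.1|exact: HG.1].
    over.
  over.
(* A double restriction depends only on the final face [H], so the sum is regrouped by [H]. *)
rewrite (exchange_big_dep xpredT)//= big1// => H _.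
by rewrite -scaler_suml incidence_square// scale0r.
Qed.

Local Notation fib F x := (@fiber_int _ _ _ _ _ S F F (ev S F x)).

(** * Transgression as a cochain map *)

Lemma fiber_int_exd F G (a : prod_forms S F G) :
  fiber_int (exd a) = fiber_int (fdelta a).
Proof.
have fL := @fiber_int_linear _ _ _ _ _ S F G.
apply/eqP; rewrite -subr_eq0 -(linB fL); apply/eqP; move: a.
have eL := @exd_linear R; have dL : linear (@fdelta _ (prod_forms S F G)).
  by have [] := fdelta_derivation (prod_forms S F G).
apply: product_ind.
- by rewrite (lin0 (eL _)) (lin0 dL) subrr (lin0 fL).
- move=> a b ha hb; rewrite (linD (eL _)) (linD dL) opprD addrACA (linD fL).
  by rewrite ha hb addr0.
- move=> b a b0 /exd_src/fiber_int_src; apply.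
  by rewrite gt_eqF// ltr_wpDl.
Qed.

Lemma exd_transgression0 F x : exd (fib F x) = (-1) ^+ Defs.dim F *: fib F (exd x).
Proof.
by rewrite fiber_int_delta -fiber_int_exd (pullback_exd (ev_pullback S F)).
Qed.

(** Under evaluation the lifted source field and [iD] have the same contraction, and under the
    integral [fdelta] may be replaced by [exd]. The commutator thus becomes the integral of the Lie
    derivative along the source field, the two dimension signs cancelling, and Stokes' formula
    applies. *)
Lemma transgression_stokes F x :
  (-1) ^+ Defs.dim F *: (iDhat S F (exd (fib F x)) - exd (iDhat S F (fib F x))) =
  \sum_(G <- fset_set [set: faces M] | `[< facet G F >])
    incidence o F G *: rho S F (fib G x).
Proof.
have iL := cohomological_linear (iDhat_cohomological S F).
have fL := @fiber_int_linear _ _ _ _ _ S F F.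
have evE := pullback_exd (ev_pullback S F).
rewrite exd_transgression0 (linZ iL) !iDhat_fiber_int !iDhat_ev evE.
rewrite fiber_int_delta -fiber_int_exd -scalerBr scalerA -expr2 sqrr_sign scale1r.
have := stokes (ev S F x); rewrite /lie subrr /ksign expr0 scale1r -(linB fL) => ->.
rewrite fsum_asbool//; apply: eq_bigr => G /asboolP [GF _].
by rewrite restr_ev// fiber_int_base_change.
Qed.

Lemma iDhat_linear F : linear (iDhat S F).
Proof. exact: cohomological_linear (iDhat_cohomological S F). Qed.

Lemma iter_iDhat_linear F k : linear (iter k (iDhat S F)).
Proof.
by elim: k => [|k IH] r a b //; exact: etrans (congr1 _ (IH r a b)) (iDhat_linear _ _ _).
Qed.

Lemma bigT_cochain_map x : bigD S (bigT S x) = bigT S (exd x).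
Proof.
apply: functional_extensionality_dep => F; apply: functional_extensionality_dep => k.
have eL := @exd_linear R; have iC := iDhat_cohomological S F.
have itL := @iter_iDhat_linear F.
rewrite bigDE /bigT /transgression (linZ (eL _)) scalerA mulrC -scalerA.
have -> : fib F (exd x) = (-1) ^+ Defs.dim F *: exd (fib F x).
  by rewrite exd_transgression0 scalerA -expr2 sqrr_sign scale1r.
rewrite (linZ (itL _)); case: k => [|k]; first by rewrite addr0.
rewrite (cohomological_iter _ _ iC) !scalerDr; congr (_ + _).
rewrite [X in _ = _ *: X]scalerA [X in _ = _ *: (X *: _)]mulrC -[X in _ = _ *: X]scalerA.
rewrite -(linZ (itL _)) transgression_stokes [RHS]scalerA.
(* The factor [k.+1] produced by the iterated commutator lowers the factorial to the one of the
   facet term. *)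
have -> : (k.+1`!%:R)^-1 * k.+1%:R = (k`!%:R)^-1 :> R.
  by rewrite factS natrM invfM mulrC mulVKf ?pnatr_eq0.
rewrite (lin_sum (itL _)) scaler_sumr; apply: eq_bigr => G /asboolP GF.
rewrite (linZ (itL _)) (linZ (rho_linear GF)) !scalerA mulrC; congr (_ *: _).
elim: k => //= k <-; rewrite iDhat_rho//; exact: GF.1.
Qed.

Lemma bigT_linear (r : R) (x y : Y) :
  bigT S (r *: x + y) = (fun F k => r *: bigT S x F k + bigT S y F k).
Proof.
apply: functional_extensionality_dep => F; apply: functional_extensionality_dep => k.
rewrite /bigT /transgression (pullback_linear (ev_pullback S F)).
by rewrite fiber_int_linear iter_iDhat_linear scalerDr !scalerA mulrC.
Qed.

Lemma bigT_pforms p (x : Y) : pforms p x -> cochains S p (bigT S x).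
Proof.
move=> hx F k; apply: pformsZ; rewrite /transgression.
have ic := iDhat_cohomological S F; have iL := cohomological_linear ic.
elim: k => [|k IH]; last first.
  have -> : p - k.+1%:Z = p - k%:Z - 1 by rewrite -addn1 PoszD opprD addrA.
  by have [[_ ib] _] := ic; exact: (pforms_bidegree iL ib IH).
rewrite subr0 /=; have [vL _ _ vb _] := ev_pullback S F.
have fL := @fiber_int_linear _ _ _ _ _ S F F.
have := pforms_bidegree vL vb hx; rewrite addr0; apply: (pforms_map fL) => j a ha.
(* Only the component of source degree zero survives integration, and there the form degree is
   preserved. *)
have [c [[hc _ fc ->] _]] := src_direct ha.
rewrite -(fsbig_widen [set b | c b != 0] setT)//; last first.
  by move=> b [_ /negP/negPn/eqP].
rewrite fsbig_finite// (lin_sum fL); apply: big_ind => [||b _]; first exact: pforms0.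
  by move=> ? ?; exact: pformsD.
have [hb sb] := hc b; have [b0|b0] := eqVneq b 0.
  by rewrite b0 in hb sb *; exact: homog_pforms (fiber_int_degree hb sb).
by rewrite (fiber_int_src b0 sb); exact: pforms0.
Qed.

End FaceComplexes.

Theorem theorem4p7 (R : realType) (n : nat) (M : manifold_with_faces R n)
    (compactM : compact [set: M]) (o : face_orientations M) (Y : target R n)
    (S : mapping_spaces o Y) :
  [/\ forall p (eta : face_family S), cochains S p eta ->
        cochains S (p + 1) (bigD S eta),
      forall (r : R) (eta xi : face_family S),
        bigD S (fun F k => r *: eta F k + xi F k) =
        (fun F k => r *: bigD S eta F k + bigD S xi F k) &
      forall p (eta : face_family S), cochains S p eta ->
        bigD S (bigD S eta) = (fun F k => 0)] /\
  [/\ forall p x, pforms p x -> cochains S p (bigT S x),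
      forall (r : R) (x y : Y),
        bigT S (r *: x + y) = (fun F k => r *: bigT S x F k + bigT S y F k) &
      forall p x, pforms p x -> bigD S (bigT S x) = bigT S (exd x)] /\
  [/\ forall p x, pforms p x -> exd x = 0 -> bigD S (bigT S x) = (fun F k => 0),
      bigD S (bigT S (alphaY Y)) = bigT S (omegaY Y) &
      bigD S (bigT S (omegaY Y)) = (fun F k => 0)].
Proof.
(* Compactness enters through the finiteness of the set of faces, which makes the facet sums
   finite. *)
have fM := finite_faces compactM.
have T0 : bigT S 0 = (fun F k => 0).
  have := bigT_linear S (-1) 0 0; rewrite scaler0 addr0 => ->.
  apply: functional_extensionality_dep => F; apply: functional_extensionality_dep => k.
  by rewrite scaleN1r addNr.
split; [split|split; split].
- exact: bigD_cochains.
- exact: bigD_linear.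
- by move=> p eta _; exact: bigD_square.
- exact: bigT_pforms.
- exact: bigT_linear.
- by move=> p x _; exact: bigT_cochain_map.
- by move=> p x _ dx; rewrite bigT_cochain_map// dx.
- by rewrite bigT_cochain_map// omegaY_exact.
- by rewrite bigT_cochain_map// omegaY_exact exdK.
Qed.
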